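(* Assume the DRSM setting below, with $\mathbf x_0\in\mathcal N$, $\alpha\in(0,\bar\alpha]$, an integer $t\ge\lceil\log_{\sigma_2}(\frac1{2\sqrt n})\rceil$, and stepsizes satisfying $0<\beta_k\le\min\{\frac{(1-\rho_t)\delta_1}{L},\frac{\alpha\delta_1}{5L}\}$ for all $k$. Suppose moreover that $(\beta_k)$ is non-increasing with $\sum_{k\ge0}\beta_k=\infty$, $\lim_k\beta_k=0$ and $\lim_k\beta_{k+1}/\beta_k=1$. Let $0<\lambda<\min\{\frac1{\rho+3L},\frac1{2(\rho+L)}\}$. Then: (i) if $\sum_{k\ge0}\beta_k^2<\infty$, there is a constant $\bar f_\lambda$ such that $\lim_{k\to\infty}f_\lambda(x_{i,k})=\lim_{k\to\infty}f_\lambda(\bar x_k)=\bar f_\lambda$ for every $i\in[n]$; (ii) there exist a sequence $a_k\ge0$ with $a_k=\mathcal O\big(\frac{L^2\beta_k^2}{(1-\rho_t)^2}\big)$ as $k\to\infty$ (with constant independent of $k$) such that $$\inf_{k\ge0}\|\bar x_k-P_{\lambda f}(\bar x_k)\|_F^2\le\frac{\lambda\Big(\bar f_\lambda(\mathbf x_0)-\min_{y\in\mathcal M}f_\lambda(y)+\sum_{k=0}^\infty a_k+\sum_{k=0}^\infty\frac{\beta_k^2L^2}{\lambda}\Big)}{\big(\frac1{2\lambda}-\rho-L\big)\sum_{k=0}^\infty\beta_k},$$ where $\bar f_\lambda(\mathbf x_0)=\frac1n\sum_{i=1}^nf_\lambda(x_{i,0})$.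
   Context: DRSM setting. Let $d\ge r\ge1$, $n\ge1$ be integers and $\mathcal M=\mathrm{St}(d,r)=\{x\in\mathbb{R}^{d\times r}:x^\top x=I_r\}$, with inner product $\langle a,b\rangle=\mathrm{tr}(a^\top b)$ and Frobenius norm. For $x\in\mathcal M$, $T_x\mathcal M=\{\xi:x^\top\xi+\xi^\top x=0\}$ and $\mathcal P_{T_x\mathcal M}(y)=y-\frac12x(y^\top x+x^\top y)$; $\mathcal P_{\mathcal M}(y)$ denotes a Frobenius-nearest point of $\mathcal M$ to $y$. Each $f_i:\mathbb{R}^{d\times r}\to\mathbb{R}$, $i\in[n]$, is $\rho$-weakly convex ($\rho\ge0$, i.e. $g_i=f_i+\frac\rho2\|\cdot\|_F^2$ is convex), with subdifferential $\partial f_i(x)=\partial g_i(x)-\rho x$ and Riemannian subdifferential $\partial_{\mathcal R}f_i(x)=\mathcal P_{T_x\mathcal M}(\partial f_i(x))$ for $x\in\mathcal M$; $f=\frac1n\sum_i f_i$. $L>0$ is a constant such that, for some bounded open convex $\mathcal U\supseteq\mathcal M$, each $f_i$ is $L$-Lipschitz on $\mathcal U$ and for all $x,y\in\mathcal M$ and $\xi\in\partial_{\mathcal R}f_i(x)$: $f_i(y)\ge f_i(x)+\langle\xi,y-x\rangle-\frac{\rho+L}{2}\|y-x\|_F^2$ (such $L$ exists); moreover $\|\xi\|_F\le L$ for all such $\xi$. Network: a connected undirected graph on $[n]$, $\mathcal N_i$ the neighbors of $i$ including $i$; the mixing matrix $W\in\mathbb{R}^{n\times n}$ is symmetric, entrywise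 nonnegative, each row sums to $1$, and $W_{ij}=0$ iff $j\notin\mathcal N_i$. $\sigma_2\in[0,1)$ is the second largest singular value of $W$; $W^t$ is the $t$-th power; $\lambda_2(\cdot),\lambda_n(\cdot)$ denote the second largest and smallest eigenvalue; $L_t=1-\lambda_n(W^t)$, $\mu_t=1-\lambda_2(W^t)$. The polar retraction is $\mathcal R_x(\xi)=(x+\xi)(I_r+\xi^\top\xi)^{-1/2}$, and $M>0$ is a constant with $\|\mathcal R_x(\xi)-(x+\xi)\|_F\le M\|\xi\|_F^2$ for all $x\in\mathcal M,\xi\in T_x\mathcal M$. DRSM: given $\alpha>0$, an integer $t\ge1$, stepsizes $\beta_k>0$ and $x_{1,0},\dots,x_{n,0}\in\mathcal M$, for $k\ge0$ and each $i$, $x_{i,k+1}=\mathcal R_{x_{i,k}}\big(\alpha\,\mathcal P_{T_{x_{i,k}}\mathcal M}(\sum_{j=1}^n(W^t)_{ij}x_{j,k})-\beta_k\xi_{i,k}\big)$ with arbitrary $\xi_{i,k}\in\partial_{\mathcal R}f_i(x_{i,k})$. Write $\mathbf x_k=(x_{1,k};\dots;x_{n,k})\in\mathbb{R}^{nd\times r}$, $\hat x_k=\frac1n\sum_ix_{i,k}$, $\bar x_k=\mathcal P_{\mathcal M}(\hat x_k)$, $\bar{\mathbf x}_k=1_n\otimes\bar x_k$ ($n$ stacked copies of $\bar x_k$), and $\|\mathbf x\|_{F,\infty}=\max_i\|x_i\|_F$. Fix constants $\delta_2\le\frac16$ and $\delta_1\le\frac{\delta_2}{5\sqrt r}$, and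 let $\mathcal N=\{\mathbf x:\|\mathbf x-\bar{\mathbf x}\|_F^2\le n\delta_1^2,\ \|\mathbf x-\bar{\mathbf x}\|_{F,\infty}\le\delta_2\}$, where for $\mathbf x=(x_1;\dots;x_n)$, $\bar{\mathbf x}=1_n\otimes\mathcal P_{\mathcal M}(\frac1n\sum_ix_i)$. Fix $\nu\in(0,1)$, and set $\Phi=2-\delta_2^2$, $\bar\alpha=\min\{\nu\Phi/L_t,1,1/M\}$, $\gamma_t=(1-4r\delta_1^2)(1-\frac{\delta_2^2}{2})\mu_t$, $\rho_t=\sqrt{1-2(1-\nu)\alpha\gamma_t}$. Moreau envelope and proximal mapping on $\mathcal M$: for $\lambda>0$, $x\in\mathcal M$, $f_\lambda(x)=\min_{y\in\mathcal M}\{f(y)+\frac1{2\lambda}\|y-x\|_F^2\}$ and $P_{\lambda f}(x)=\arg\min_{y\in\mathcal M}\{f(y)+\frac1{2\lambda}\|y-x\|_F^2\}$ (single-valued for the $\lambda$ considered). *)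

(* Defs.v *)
From HB Require Import structures.
From mathcomp Require Import all_boot all_order all_algebra.
From mathcomp Require Import all_classical all_reals all_analysis.
Set Implicit Arguments. Unset Strict Implicit. Unset Printing Implicit Defensive.
Import Order.TTheory GRing.Theory Num.Theory.
Local Open Scope ring_scope.
Local Open Scope classical_set_scope.

Section DRSM.
Variable R : realType.

Definition frob_inner (m p : nat) (a b : 'M[R]_(m, p)) : R := \tr (a^T *m b).
Definition frob (m p : nat) (a : 'M[R]_(m, p)) : R := Num.sqrt (frob_inner a a).

Definition stiefel {d r : nat} : set 'M[R]_(d, r) := [set x | x^T *m x = 1%:M].

Definition tangent (d r : nat) (x : 'M[R]_(d, r)) : set 'M[R]_(d, r) :=
  [set xi | x^T *m xi + xi^T *m x = 0].
Definition proj_tangent (d r : nat) (x y : 'M[R]_(d, r)) : 'M[R]_(d, r) :=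
  y - (2%:R)^-1 *: (x *m (y^T *m x + x^T *m y)).

Definition nearest_stiefel (d r : nat) (y z : 'M[R]_(d, r)) : Prop :=
  stiefel z /\ forall w, stiefel w -> frob (z - y) <= frob (w - y).

Definition convex_fun (d r : nat) (g : 'M[R]_(d, r) -> R) : Prop :=
  forall x y (a : R), 0 <= a -> a <= 1 ->
    g (a *: x + (1 - a) *: y) <= a * g x + (1 - a) * g y.

Definition weakly_convex (d r : nat) (rho : R) (f : 'M[R]_(d, r) -> R) : Prop :=
  convex_fun (fun x => f x + rho / 2%:R * frob x ^+ 2).

Definition conv_subdiff (d r : nat) (g : 'M[R]_(d, r) -> R) (x : 'M[R]_(d, r))
  : set 'M[R]_(d, r) :=
  [set G | forall y, g x + frob_inner G (y - x) <= g y].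

Definition wc_subdiff (d r : nat) (rho : R) (f : 'M[R]_(d, r) -> R) (x : 'M[R]_(d, r))
  : set 'M[R]_(d, r) :=
  [set G - rho *: x | G in conv_subdiff (fun z => f z + rho / 2%:R * frob z ^+ 2) x].

Definition riem_subdiff (d r : nat) (rho : R) (f : 'M[R]_(d, r) -> R) (x : 'M[R]_(d, r))
  : set 'M[R]_(d, r) :=
  [set proj_tangent x G | G in wc_subdiff rho f x].

(* symmetric positive semidefinite square root (exists uniquely for a
   symmetric psd matrix), and the polar retraction *)
Definition psd (r : nat) (S : 'M[R]_r) : Prop :=
  forall v : 'cV[R]_r, 0 <= (v^T *m S *m v) ord0 ord0.
Definition sqrtm (r : nat) (A : 'M[R]_r) : 'M[R]_r :=
  xget 0 [set S : 'M[R]_r | S^T = S /\ psd S /\ S *m S = A].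
Definition polar_retr (d r : nat) (x xi : 'M[R]_(d, r)) : 'M[R]_(d, r) :=
  (x + xi) *m invmx (sqrtm (1%:M + xi^T *m xi)).

Definition mxpow (n : nat) (W : 'M[R]_n) (t : nat) : 'M[R]_n := iter t (mulmx W) 1%:M.

Definition spectrum (n : nat) (A : 'M[R]_n) : seq R :=
  xget [::] [set s : seq R | sorted (>=%R) s /\
                             char_poly A = \prod_(z <- s) ('X - z%:P)].
Definition eig2 (n : nat) (A : 'M[R]_n) : R := nth 0 (spectrum A) 1.
Definition eign (n : nat) (A : 'M[R]_n) : R := nth 0 (spectrum A) n.-1.
Definition sing2 (n : nat) (A : 'M[R]_n) : R := Num.sqrt (eig2 (A^T *m A)).

Definition logb (b x : R) : R := ln x / ln b.

(* the neighborhood N, relative to a chosen nearest point xb of the average *)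
Definition in_nbhd (n d r : nat) (delta1 delta2 : R) (x : 'I_n -> 'M[R]_(d, r))
  (xb : 'M[R]_(d, r)) : Prop :=
  \sum_(i < n) frob (x i - xb) ^+ 2 <= n%:R * delta1 ^+ 2 /\
  forall i, frob (x i - xb) <= delta2.

(* Moreau envelope of f on St(d,r) (the minimum is attained, so it equals the inf) *)
Definition moreau (d r : nat) (f : 'M[R]_(d, r) -> R) (lam : R) (x : 'M[R]_(d, r)) : R :=
  inf [set f y + (2%:R * lam)^-1 * frob (y - x) ^+ 2 | y in stiefel].

Definition is_prox (d r : nat) (f : 'M[R]_(d, r) -> R) (lam : R) (x y : 'M[R]_(d, r)) : Prop :=
  stiefel y /\ forall z, stiefel z ->
    f y + (2%:R * lam)^-1 * frob (y - x) ^+ 2 <= f z + (2%:R * lam)^-1 * frob (z - x) ^+ 2.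

Definition alphabar (Lt nu Phi M : R) : R :=
  if Lt == 0 then Num.min 1 M^-1 else Num.min (nu * Phi / Lt) (Num.min 1 M^-1).

Definition gamma_t (r : nat) (delta1 delta2 mut : R) : R :=
  (1 - 4%:R * r%:R * delta1 ^+ 2) * (1 - delta2 ^+ 2 / 2%:R) * mut.
Definition rho_t (nu alpha gammat : R) : R :=
  Num.sqrt (1 - 2%:R * (1 - nu) * alpha * gammat).

Definition favg (n d r : nat) (f : 'I_n -> 'M[R]_(d, r) -> R) (y : 'M[R]_(d, r)) : R :=
  n%:R^-1 * \sum_(i < n) f i y.

Definition frob_open (d r : nat) (U : set 'M[R]_(d, r)) : Prop :=
  forall x, U x -> exists2 e : R, 0 < e & forall y, frob (y - x) < e -> U y.
Definition frob_bounded (d r : nat) (U : set 'M[R]_(d, r)) : Prop :=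
  exists C : R, forall x, U x -> frob x <= C.
Definition convex_set_mx (d r : nat) (U : set 'M[R]_(d, r)) : Prop :=
  forall x y (a : R), U x -> U y -> 0 <= a -> a <= 1 -> U (a *: x + (1 - a) *: y).

End DRSM.
Arguments stiefel {R d r}.

(* Main.v *)
(** Consensus.  Write [A = W ^ t], let [xb] be the projected mean of the points [x_i] and [-g_i] the
    Riemannian gradient of the consensus potential.  On the Stiefel manifold
    [(x - y)^T (x - y) = 2 - (x^T y + y^T x)], so every normal component that appears is quadratic in the
    consensus error.  Together with the spectral gap of [A] this gives a restricted secant inequality, and since
    the polar retraction does not increase distances to points of the manifold, one step contracts the
    consensus error by [rho_t] up to a forcing of size [beta_k].  Hence the neighbourhood is invariant, and
    since [beta_{k+1} / beta_k] tends to 1, the consensus error is [O (beta_k)].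

    Descent.  For points of the manifold [|y - x|^2 = 2 r - 2 <y, x>], so testing the Moreau envelope at
    [xb_{k+1}] with the proximal point [P xb_k] produces a term that is linear in [xb_{k+1} - xb_k].  Up to
    [O (beta_k ^ 2)] this difference is [- beta_k] times the averaged subgradient, whence
    [f_lam xb_{k+1} <= f_lam xb_k - c beta_k |xb_k - P xb_k|^2 + O (beta_k ^ 2)].  If [sum beta_k ^ 2] is finite
    the envelope values converge and [inf_k |xb_k - P xb_k|^2 = 0]; if it is infinite the right-hand side of (ii)
    is infinite.  In both cases [a_k = 0] is admissible in (ii). *)
Require Import Defs.
From HB Require Import structures.
From mathcomp Require Import all_boot all_order all_algebra.
From mathcomp Require Import all_classical all_reals all_analysis.
From mathcomp Require Import fingroup perm complex ring lra.
Import Order.TTheory GRing.Theory Num.Theory.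
Import numFieldNormedType.Exports.
Local Open Scope ring_scope.
Local Open Scope classical_set_scope.
Set Implicit Arguments. Unset Strict Implicit. Unset Printing Implicit Defensive.

Local Notation ip := frob_inner.

(** * Frobenius inner product *)

Section Frobenius.
Variable R : realType.

Section Inner.
Variables m p : nat.
Implicit Types a b c : 'M[R]_(m, p).

Lemma ipE a b : ip a b = \sum_i \sum_j a i j * b i j.
Proof.
rewrite /frob_inner /mxtrace exchange_big /=; apply: eq_bigr => i _.
by rewrite mxE; apply: eq_bigr => j _; rewrite mxE.
Qed.

Lemma ipC a b : ip a b = ip b a.
Proof. by rewrite !ipE; apply: eq_bigr => i _; apply: eq_bigr => j _; rewrite mulrC. Qed.

Lemma ipDr a b c : ip a (b + c) = ip a b + ip a c.
Proof. by rewrite /frob_inner mulmxDr mxtraceD. Qed.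
Lemma ipZr k a b : ip a (k *: b) = k * ip a b.
Proof. by rewrite /frob_inner -scalemxAr mxtraceZ. Qed.
Lemma ipNr a b : ip a (- b) = - ip a b.
Proof. by rewrite /frob_inner mulmxN raddfN. Qed.
Lemma ip0r a : ip a 0 = 0.
Proof. by rewrite /frob_inner mulmx0 mxtrace0. Qed.
Lemma ipDl a b c : ip (a + b) c = ip a c + ip b c.
Proof. by rewrite ipC ipDr !(ipC c). Qed.
Lemma ipZl k a b : ip (k *: a) b = k * ip a b.
Proof. by rewrite ipC ipZr (ipC b). Qed.
Lemma ipNl a b : ip (- a) b = - ip a b.
Proof. by rewrite ipC ipNr (ipC b). Qed.
Lemma ip0l a : ip 0 a = 0.
Proof. by rewrite ipC ip0r. Qed.
Lemma ip_sumr (I : Type) (s : seq I) (P : pred I) a (F : I -> 'M[R]_(m, p)) :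
  ip a (\sum_(i <- s | P i) F i) = \sum_(i <- s | P i) ip a (F i).
Proof. by apply: (big_morph (ip a)); [exact: ipDr|exact: ip0r]. Qed.
Lemma ip_suml (I : Type) (s : seq I) (P : pred I) a (F : I -> 'M[R]_(m, p)) :
  ip (\sum_(i <- s | P i) F i) a = \sum_(i <- s | P i) ip (F i) a.
Proof. by rewrite ipC ip_sumr; apply: eq_bigr => i _; rewrite ipC. Qed.

Definition ip_expand := (ipDr, ipDl, ipNr, ipNl, ipZr, ipZl, ip0r, ip0l).

Lemma ip_ge0 a : 0 <= ip a a.
Proof. by rewrite ipE; do 2!apply: sumr_ge0 => ? _; rewrite -expr2 sqr_ge0. Qed.

Lemma frob_sqr a : frob a ^+ 2 = ip a a.
Proof. by rewrite sqr_sqrtr // ip_ge0. Qed.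
Lemma frob_ge0 a : 0 <= frob a.
Proof. exact: sqrtr_ge0. Qed.
Lemma frob0 : frob (0 : 'M[R]_(m, p)) = 0.
Proof. by rewrite /frob ip0r sqrtr0. Qed.
Lemma ip_eq0 a : ip a a = 0 -> a = 0.
Proof.
rewrite ipE => /eqP; rewrite psumr_eq0; last first.
  by move=> i _; apply: sumr_ge0 => j _; rewrite -expr2 sqr_ge0.
move=> /allP H; apply/matrixP => i j; rewrite mxE.
have := H i (mem_index_enum _); rewrite psumr_eq0 => [|k _]; last by rewrite -expr2 sqr_ge0.
by move=> /allP /(_ j (mem_index_enum _)) /=; rewrite mulf_eq0 orbb => /eqP.
Qed.
Lemma frob_eq0 a : frob a = 0 -> a = 0.
Proof. by move=> H; apply: ip_eq0; rewrite -frob_sqr H expr0n. Qed.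
Lemma frobN a : frob (- a) = frob a.
Proof. by rewrite /frob ipNl ipNr opprK. Qed.
Lemma frobBC a b : frob (a - b) = frob (b - a).
Proof. by rewrite -frobN opprB. Qed.
Lemma frobZ k a : frob (k *: a) = `|k| * frob a.
Proof. by rewrite /frob ipZl ipZr mulrA -expr2 sqrtrM ?sqr_ge0 // sqrtr_sqr. Qed.

Lemma frob_leP a (c : R) : 0 <= c -> ip a a <= c ^+ 2 -> frob a <= c.
Proof. by move=> c0; rewrite -frob_sqr ler_sqr ?nnegrE ?frob_ge0. Qed.

(** Cauchy-Schwarz: the squared norm of [ip b b *: a - ip a b *: b] is [ip b b] times the gap
    between the two sides. *)
Lemma ip_sqr_le a b : ip a b ^+ 2 <= ip a a * ip b b.
Proof.
have [b0|b0] := eqVneq (ip b b) 0.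
  by rewrite (ip_eq0 b0) !ip0r mulr0 expr0n.
have bp : 0 < ip b b by rewrite lt_def b0 ip_ge0.
have := ip_ge0 (ip b b *: a - ip a b *: b).
rewrite !ip_expand (ipC b a).
set x := ip a b; set A := ip a a; set B := ip b b.
rewrite (_ : _ + _ = B * (A * B - x ^+ 2)); last by rewrite /B; ring.
by rewrite pmulr_rge0 // subr_ge0.
Qed.

Lemma ip_le a b : ip a b <= frob a * frob b.
Proof.
apply: le_trans (ler_norm _) _.
rewrite -(@ler_sqr _) ?nnegrE ?mulr_ge0 ?frob_ge0 //.
by rewrite exprMn !frob_sqr real_normK ?num_real // ip_sqr_le.
Qed.
Lemma ip_geN a b : - (frob a * frob b) <= ip a b.
Proof. by rewrite lerNl -ipNl -(frobN a) ip_le. Qed.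

Lemma frobD a b : frob (a + b) <= frob a + frob b.
Proof.
apply: frob_leP; first by rewrite addr_ge0 ?frob_ge0.
rewrite !ip_expand sqrrD !frob_sqr (ipC b a).
have := ip_le a b; lra.
Qed.
Lemma frobB a b : frob (a - b) <= frob a + frob b.
Proof. by rewrite -(frobN b) frobD. Qed.
Lemma frob_triangle b a c : frob (a - c) <= frob (a - b) + frob (b - c).
Proof. by rewrite (le_trans _ (frobD _ _)) // addrA subrK. Qed.
Lemma frob_sum (I : Type) (s : seq I) (P : pred I) (F : I -> 'M[R]_(m, p)) :
  frob (\sum_(i <- s | P i) F i) <= \sum_(i <- s | P i) frob (F i).
Proof.
elim/big_ind2 : _ => [|a x b y ? ?|//]; first by rewrite frob0.
by apply: le_trans (frobD _ _) _; apply: lerD.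
Qed.
Lemma frob_sqrB a b : frob (a - b) ^+ 2 = frob a ^+ 2 - 2%:R * ip a b + frob b ^+ 2.
Proof. by rewrite !frob_sqr !ip_expand (ipC b a); ring. Qed.
Lemma frob_sqrD a b : frob (a + b) ^+ 2 = frob a ^+ 2 + 2%:R * ip a b + frob b ^+ 2.
Proof. by rewrite !frob_sqr !ip_expand (ipC b a); ring. Qed.
End Inner.

Lemma ip_tr m p (a b : 'M[R]_(m, p)) : ip a^T b^T = ip a b.
Proof. by rewrite /frob_inner trmxK -mxtrace_tr trmx_mul trmxK mxtrace_mulC. Qed.
Lemma frob_tr m p (a : 'M[R]_(m, p)) : frob a^T = frob a.
Proof. by rewrite /frob ip_tr. Qed.
Lemma ip_mull m q p (a : 'M[R]_(m, q)) (b : 'M[R]_(q, p)) c : ip (a *m b) c = ip b (a^T *m c).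
Proof. by rewrite /frob_inner trmx_mul mulmxA. Qed.
Lemma ip_mulr m q p (a : 'M[R]_(m, q)) (b : 'M[R]_(q, p)) c : ip (a *m b) c = ip a (c *m b^T).
Proof. by rewrite -ip_tr trmx_mul ip_mull -ip_tr !trmxK trmx_mul !trmxK. Qed.

(** Cauchy-Schwarz is applied to every entry of the product, a row of [a] against a column of
    [b]. *)
Lemma frob_mul m q p (a : 'M[R]_(m, q)) (b : 'M[R]_(q, p)) : frob (a *m b) <= frob a * frob b.
Proof.
apply: frob_leP; first by rewrite mulr_ge0 ?frob_ge0.
rewrite exprMn !frob_sqr !ipE mulr_suml ler_sum // => i _.
rewrite mulrC mulr_suml [leRHS](_ : _ = \sum_(j < p) (\sum_k a i k * a i k) * (\sum_k b k j * b k j)).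
  apply: ler_sum => j _; rewrite mxE -expr2.
  have := @ip_sqr_le 1 q (row i a) (col j b)^T.
  rewrite !ipE !big_ord1.
  by under eq_bigr => ? _ do rewrite !mxE; under [X in _ <= X * _]eq_bigr => ? _ do rewrite !mxE;
     under [X in _ <= _ * X]eq_bigr => ? _ do rewrite !mxE.
by rewrite -mulr_sumr -mulr_suml mulrC exchange_big.
Qed.
End Frobenius.

(** * Spectral theorem for real symmetric matrices *)

Section Spectral.
Variable R : realType.

(** Take a complex eigenvector [u + i w]. Comparing [ip (u *m A) w] with [ip u (w *m A)] shows that
    the imaginary part of the eigenvalue, multiplied by [|u|^2 + |w|^2], vanishes. So [u] or [w],
    whichever is nonzero, is a real eigenvector. *)
Lemma symmetric_eigenvector n (A : 'M[R]_n.+1) : A^T = A ->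
  exists2 v : 'rV[R]_n.+1, ip v v = 1 & exists a : R, v *m A = a *: v.
Proof.
move=> As; pose toC : R -> R[i] := fun x => (x%:C)%C.
have [a /eigenvalueP [z zA z0]] :=
  spectral.eigenvalue_closed (map_mx toC A) (ltn0Sn n).
pose u : 'rV[R]_n.+1 := map_mx (@complex.Re R) z; pose w : 'rV[R]_n.+1 := map_mx (@complex.Im R) z.
have ReE (i : 'I_n.+1) : complex.Re ((z *m map_mx toC A) 0 i) = (u *m A) 0 i.
  rewrite !mxE (big_morph (@complex.Re R) (op1 := +%R) (id1 := 0)) //; last by case=> ? ? [].
  by apply: eq_bigr => j _; rewrite !mxE; case: (z 0 j) => p q /=; rewrite mulr0 subr0.
have ImE (i : 'I_n.+1) : complex.Im ((z *m map_mx toC A) 0 i) = (w *m A) 0 i.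
  rewrite !mxE (big_morph (@complex.Im R) (op1 := +%R) (id1 := 0)) //; last by case=> ? ? [].
  by apply: eq_bigr => j _; rewrite !mxE; case: (z 0 j) => p q /=; rewrite mulr0 add0r.
have uA : u *m A = complex.Re a *: u - complex.Im a *: w.
  apply/rowP => i; rewrite -ReE zA !mxE.
  by case: (a) => p q; case: (z 0 i) => p' q' /=.
have wA : w *m A = complex.Re a *: w + complex.Im a *: u.
  apply/rowP => i; rewrite -ImE zA !mxE.
  by case: (a) => p q; case: (z 0 i) => p' q' /=.
have uw0 : u != 0 \/ w != 0.
  have [u0|] := eqVneq u 0; last by left.
  have [w0|] := eqVneq w 0; last by right.
  case/eqP: z0; apply/rowP => i; rewrite mxE.
  have := congr1 (fun M : 'rV[R]_n.+1 => M 0 i) u0; have := congr1 (fun M : 'rV[R]_n.+1 => M 0 i) w0.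
  by rewrite !mxE; case: (z 0 i) => p q /= -> ->.
have ge_u := ip_ge0 u; have ge_w := ip_ge0 w.
have pos : 0 < ip u u + ip w w.
  rewrite lt_def addr_ge0 // andbT; apply/eqP => e.
  by case: uw0 => /eqP; apply; apply: ip_eq0; lra.
have a0 : complex.Im a = 0.
  have : ip (u *m A) w = ip u (w *m A) by rewrite ip_mulr As.
  rewrite uA wA !ip_expand => e.
  have : complex.Im a * (ip u u + ip w w) = 0 by lra.
  by move/eqP; rewrite mulf_eq0 (gt_eqF pos) orbF => /eqP.
have fin (x : 'rV[R]_n.+1) : x != 0 -> x *m A = complex.Re a *: x ->
    exists2 v : 'rV[R]_n.+1, ip v v = 1 & exists a : R, v *m A = a *: v.
  move=> x0 xA; have f0 : frob x != 0 by apply: contraNN x0 => /eqP /frob_eq0 ->.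
  exists ((frob x)^-1 *: x).
    by rewrite !ip_expand -frob_sqr; field.
  by exists (complex.Re a); rewrite -scalemxAl xA !scalerA mulrC.
case: uw0 => ?; [apply: (fin u)|apply: (fin w)] => //.
  by rewrite uA a0 scale0r subr0.
by rewrite wA a0 scale0r addr0.
Qed.

(* A Householder reflection swaps [v] and the first basis vector. *)
Lemma orthogonal_completion n (v : 'rV[R]_n.+1) : ip v v = 1 ->
  exists2 H : 'M[R]_n.+1, H *m H^T = 1%:M & delta_mx 0 0 *m H = v.
Proof.
move=> v1; pose e : 'rV[R]_n.+1 := delta_mx 0 0.
have e1 : ip e e = 1.
  rewrite ipE big_ord1 (bigD1 ord0) //= big1 => [|i /negPf i0]; rewrite !mxE ?i0 ?eqxx /=; ring.
have [<-|ve] := eqVneq e v; first by exists 1%:M; rewrite ?trmx1 ?mulmx1.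
pose w := v - e; pose c := ip w w.
have c0 : c != 0 by apply: contraNN ve => /eqP /ip_eq0 /eqP; rewrite subr_eq0 eq_sym.
have ipw (a b : 'rV[R]_n.+1) : a *m b^T = (ip a b)%:M.
  by rewrite [LHS]mx11_scalar -trace_mx11 mxtrace_mulC -mxtrace_tr trmx_mul trmxK.
pose H := 1%:M - (2%:R / c) *: (w^T *m w).
have Hs : H^T = H by rewrite /H raddfB /= linearZ /= trmx_mul trmxK trmx1.
have wH : w *m H = - w.
  rewrite /H mulmxBr mulmx1 -scalemxAr mulmxA ipw mul_scalar_mx scalerA.
  by rewrite -/c divfK // scaler_nat mulr2n opprD addrA subrr sub0r.
exists H; rewrite ?Hs.
  rewrite {1}/H mulmxBl mul1mx -scalemxAl -mulmxA wH mulmxN scalerN opprK.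
  by rewrite /H subrK.
rewrite -/e {1}/H mulmxBr mulmx1 -scalemxAr mulmxA ipw mul_scalar_mx scalerA.
have -> : 2%:R / c * ip e w = -1.
  have : c = - (2%:R * ip e w) by rewrite /c /w !ip_expand v1 e1 (ipC v e); ring.
  by move=> E; rewrite [in LHS]mulrAC -[X in X / c]opprK -E mulNr divff.
by rewrite scaleN1r opprK /w addrC subrK.
Qed.

(** Induction on the size: an orthogonal change of basis sending the first basis vector to a unit
    eigenvector splits off a 1 by 1 block. In this convention the eigenvectors are the rows of
    [U]. *)
Lemma symmetric_spectral n (A : 'M[R]_n) : A^T = A ->
  exists U : 'M[R]_n, exists D : 'rV[R]_n,
    U *m U^T = 1%:M /\ A = U^T *m diag_mx D *m U.
Proof.
elim: n A => [|n IH] A As.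
  by exists 1%:M, 0; split; apply/matrixP => -[].
have [v v1 [a va]] := symmetric_eigenvector As.
have [H HH eH] := orthogonal_completion v1.
have HtH : H^T *m H = 1%:M by apply: mulmx1C.
pose B : 'M[R]_(1 + n) := H *m A *m H^T.
have Bs : B^T = B by rewrite /B !trmx_mul trmxK As mulmxA.
have vH : v *m H^T = delta_mx 0 0 by rewrite -eH -mulmxA HH mulmx1.
have eB : delta_mx 0 0 *m B = a *: (delta_mx 0 0 : 'rV[R]_(1 + n)).
  by rewrite /B !mulmxA eH va -scalemxAl vH.
have B0 i : B 0 i = a * (i == 0)%:R.
  have := congr1 (fun M : 'rV[R]_(1 + n) => M 0 i) eB.
  by rewrite -rowE !mxE /= => ->.
have BE : B = block_mx a%:M 0 0 (drsubmx B).
  have l0 : lshift n (0 : 'I_1) = 0 by apply: val_inj.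
  have ur0 : ursubmx B = 0.
    by apply/matrixP => i j; rewrite (ord1 i) 2!mxE l0 B0 mulr0 mxE.
  rewrite -[LHS]submxK ur0 -[dlsubmx B]trmxK trmx_dlsub Bs ur0 trmx0.
  congr (block_mx _ _ _ _); apply/matrixP => i j.
  by rewrite (ord1 i) (ord1 j) 2!mxE !l0 B0 eqxx mulr1 mxE.
have [|U [D [UU BD]]] := IH (drsubmx B); first by rewrite trmx_drsub Bs.
pose K : 'M[R]_(1 + n) := block_mx (1%:M : 'M[R]_1) 0 0 U.
pose E : 'rV[R]_(1 + n) := row_mx (a%:M : 'rV[R]_1) D.
have KK : K *m K^T = 1%:M.
  rewrite /K tr_block_mx mulmx_block !trmx0 !trmx1.
  by rewrite !(mulmx0, mul0mx, mulmx1, addr0, add0r) UU -scalar_mx_block.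
have KB : K^T *m diag_mx E *m K = B.
  rewrite /K /E diag_mx_row tr_block_mx !trmx0 trmx1 !mulmx_block.
  rewrite !(mulmx0, mul0mx, mulmx1, mul1mx, addr0, add0r) -BD [RHS]BE.
  congr (block_mx _ _ _ _).
  by apply/matrixP => i j; rewrite !ord1 !mxE.
exists (K *m H : 'M[R]_n.+1), E; split.
  by rewrite trmx_mul mulmxA -(mulmxA K H) HH mulmx1 KK.
rewrite trmx_mul -!mulmxA (mulmxA (diag_mx E)) (mulmxA K^T) (mulmxA K^T) KB.
by rewrite /B -!mulmxA HtH mulmx1 mulmxA HtH mul1mx.
Qed.
End Spectral.

(** * Polar retraction on the Stiefel manifold *)

Section Polar.
Variable R : realType.

(** Two psd matrices have nonnegative inner product: after moving [U] across, only the diagonal of a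
    Gram matrix, weighted by [D], remains. *)
Lemma ip_diag_gram_ge0 m n (U : 'M[R]_n) (D : 'rV[R]_n) (B : 'M[R]_(m, n)) :
  (forall i, 0 <= D 0 i) -> 0 <= ip (U^T *m diag_mx D *m U) (B^T *m B).
Proof.
move=> D0; rewrite ip_mulr ip_mull trmxK.
have -> : U *m (B^T *m B *m U^T) = (B *m U^T)^T *m (B *m U^T).
  by rewrite trmx_mul trmxK !mulmxA.
rewrite ipE; apply: sumr_ge0 => i _; rewrite (bigD1 i) //= big1 => [|j ji].
  rewrite addr0 mxE eqxx mulr1n mulr_ge0 // mxE; apply: sumr_ge0 => k _.
  by rewrite mxE -expr2 sqr_ge0.
by rewrite !mxE eq_sym (negPf ji) mul0r.
Qed.

Lemma psd_diag_ge0 n (U A : 'M[R]_n) i : psd A -> 0 <= (U *m A *m U^T) i i.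
Proof.
move=> /(_ (row i U)^T); rewrite trmxK.
suff -> : row i U *m A *m (row i U)^T = ((U *m A *m U^T) i i)%:M by rewrite mxE.
rewrite [LHS]mx11_scalar; congr _%:M.
by rewrite -row_mul mxE [RHS]mxE; apply: eq_bigr => k _; rewrite !mxE.
Qed.

(** [sqrtm] is a choice with default 0, so its specification needs one explicit root: take square
    roots of the eigenvalues, which are nonnegative because [A] is psd. *)
Lemma sqrtmP n (A : 'M[R]_n) : A^T = A -> psd A ->
  [/\ (sqrtm A)^T = sqrtm A, psd (sqrtm A) & sqrtm A *m sqrtm A = A].
Proof.
move=> As Ap; suff [S HS] : exists S : 'M[R]_n, S^T = S /\ psd S /\ S *m S = A.
  rewrite /sqrtm.
  by have [? [? ?]] : [set S : 'M[R]_n | S^T = S /\ psd S /\ S *m S = A] (sqrtm A) by apply: xgetPex; exists S.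
have [U [D [UU AE]]] := symmetric_spectral As.
have UtU := mulmx1C UU.
have D0 i : 0 <= D 0 i.
  have := psd_diag_ge0 U i Ap.
  by rewrite AE !mulmxA UU mul1mx -mulmxA UU mulmx1 mxE eqxx mulr1n.
pose E : 'rV[R]_n := \row_i Num.sqrt (D 0 i).
exists (U^T *m diag_mx E *m U); split; [|split].
- by rewrite !trmx_mul trmxK tr_diag_mx mulmxA.
- move=> v; set S := _ *m U.
  have E0 i : 0 <= E 0 i by rewrite mxE sqrtr_ge0.
  have := ip_diag_gram_ge0 U v^T E0; rewrite -/S trmxK ipC ip_mull.
  by rewrite /frob_inner trmxK mxtrace_mulC trace_mx11.
- rewrite -!mulmxA (mulmxA U) UU mul1mx (mulmxA (diag_mx E)) mulmx_diag AE -!mulmxA.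
  congr (_ *m (diag_mx _ *m _)); apply/rowP => i.
  by rewrite !mxE -expr2 sqr_sqrtr.
Qed.

Section Stiefel.
Variables d r : nat.
Implicit Types x y z xi : 'M[R]_(d, r).

Lemma ip_stiefel x : stiefel x -> ip x x = r%:R.
Proof. by rewrite /stiefel /frob_inner /= => ->; rewrite mxtrace1. Qed.
Lemma frob_stiefel x : stiefel x -> frob x = Num.sqrt r%:R.
Proof. by move=> /ip_stiefel; rewrite /frob => ->. Qed.
Lemma frob_stiefel_mul n x (a : 'M[R]_(r, n)) : stiefel x -> frob (x *m a) = frob a.
Proof. by move=> sx; rewrite /frob ip_mull mulmxA sx mul1mx. Qed.
Lemma stiefel_gram x y : stiefel x -> stiefel y ->
  (x - y)^T *m (x - y) = 2%:R *: 1%:M - (x^T *m y + y^T *m x).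
Proof.
move=> sx sy; rewrite [(x - y)^T]raddfB /= mulmxBl !mulmxBr sx sy scaler_nat mulr2n.
by rewrite opprB addrACA -opprD.
Qed.

Section Polar.
Variables (x xi : 'M[R]_(d, r)).
Hypotheses (sx : stiefel x) (tx : tangent x xi).
Let S := sqrtm (1%:M + xi^T *m xi).

Lemma tangent_gram : (x + xi)^T *m (x + xi) = 1%:M + xi^T *m xi.
Proof.
by rewrite [(x + xi)^T]raddfD /= mulmxDl !mulmxDr sx addrA -(addrA 1%:M) tx addr0.
Qed.

Lemma polar_sqrt : [/\ S^T = S, psd S & S *m S = (x + xi)^T *m (x + xi)].
Proof.
rewrite tangent_gram; apply: sqrtmP; first by rewrite raddfD /= trmx1 trmx_mul trmxK.
move=> v; rewrite mulmxDr mulmxDl mulmx1 mxE addr_ge0 //.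
  by rewrite -trace_mx11; exact: ip_ge0.
by rewrite mulmxA -mulmxA -trmx_mul -trace_mx11; exact: ip_ge0.
Qed.

(** [S ^ 2 = 1 + xi^T xi] dominates the identity, so the eigenvalues of [S] are at least 1. Hence
    [S] is invertible and [S - 1] is psd; [D] lists the eigenvalues of [S - 1]. *)
Lemma polar_sqrt_spectral : exists U : 'M[R]_r, exists D : 'rV[R]_r,
  [/\ U *m U^T = 1%:M, S - 1%:M = U^T *m diag_mx D *m U, S \in unitmx & forall i, 0 <= D 0 i].
Proof.
have [St Sp SS] := polar_sqrt.
have [U [E [UU SE]]] := symmetric_spectral St.
have UtU := mulmx1C UU.
have USU : U *m S *m U^T = diag_mx E.
  by rewrite SE !mulmxA UU mul1mx -mulmxA UU mulmx1.
have E0 i : 0 <= E 0 i.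
  by have := psd_diag_ge0 U i Sp; rewrite USU mxE eqxx mulr1n.
(* The [i]-th diagonal entry of [U S^2 U^T] is 1 plus the squared norm of row [i] of [U *m xi^T]. *)
have E1 i : 1 <= E 0 i.
  have : (diag_mx E *m diag_mx E) i i = (U *m (1%:M + xi^T *m xi) *m U^T) i i.
    rewrite -USU; congr (fun_of_matrix _ i i).
    rewrite -tangent_gram -SS.
    by rewrite !mulmxA -(mulmxA _ U^T) UtU mulmx1.
  rewrite mulmx_diag mulmxDr mulmx1 mulmxDl UU [LHS]mxE eqxx mulr1n [LHS]mxE [RHS]mxE [X in X + _]mxE eqxx mulr1n => e.
  rewrite -(@ler_sqr _ 1 (E 0 i)) ?nnegrE // expr1n expr2 e lerDl.
  have := @ip_ge0 _ _ _ (row i (U *m xi^T)).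
  rewrite ipE big_ord1 => /le_trans; apply.
  have -> : U *m (xi^T *m xi) *m U^T = (U *m xi^T) *m (U *m xi^T)^T.
    by rewrite trmx_mul trmxK !mulmxA.
  rewrite [X in _ <= X]mxE.
  by apply: ler_sum => k _; rewrite ![row _ _ _ _]mxE [_^T _ _]mxE.
exists U, (E - const_mx 1); split => //.
- rewrite raddfB /= diag_const_mx mulmxBr mulmx1 mulmxBl UtU -SE.
  by [].
- have Eu : diag_mx E \in unitmx.
    rewrite unitmxE det_diag; apply: rpred_prod => i _.
    by rewrite unitfE gt_eqF // (lt_le_trans ltr01).
  rewrite SE !unitmx_mul Eu andbT.
  by have := mulmx1_unit UU => -[-> ->].
- by move=> i; rewrite !mxE subr_ge0.
Qed.
End Polar.
End Stiefel.
End Polar.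

(** * Tangent projection, nonexpansiveness of the retraction, optimality of nearest points *)

Section Retraction.
Variable R : realType.
Variables d r : nat.
Implicit Types x y z xi : 'M[R]_(d, r).

Lemma polar_stiefel x xi : stiefel x -> tangent x xi -> stiefel (polar_retr x xi).
Proof.
move=> sx tx; have [St _ SS] := polar_sqrt sx tx.
have [U [D [_ _ Su _]]] := polar_sqrt_spectral sx tx.
rewrite /stiefel /= /polar_retr trmx_mul trmx_inv St mulmxA -(mulmxA (invmx _)).
by rewrite -SS mulmxA mulVmx // mul1mx mulmxV.
Qed.

(* With [x + xi = R *m S] and [T = S - 1] psd, expanding [R *m S - y = (R - y) + R *m T]
   leaves the cross term [ip (1 - R^T y) T = ip ((R - y)^T (R - y)) T / 2 >= 0]. *)
Lemma polar_nonexpansive x xi y : stiefel x -> tangent x xi -> stiefel y ->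
  frob (polar_retr x xi - y) <= frob (x + xi - y).
Proof.
move=> sx tx sy; have sR := polar_stiefel sx tx.
have [St _ _] := polar_sqrt sx tx.
have [U [D [_ TE Su D0]]] := polar_sqrt_spectral sx tx.
set S := sqrtm _ in St TE Su; set Q := polar_retr x xi in sR *.
set T := S - 1%:M in TE.
have xE : x + xi = Q *m S by rewrite /Q /polar_retr -/S mulmxKV.
have -> : x + xi - y = (Q - y) + Q *m T.
  by rewrite xE /T mulmxBr mulmx1 [RHS]addrC addrA subrK.
rewrite -(@ler_sqr _ (frob _)) ?nnegrE ?frob_ge0 // [X in _ <= X]frob_sqrD -addrA lerDl.
rewrite addr_ge0 ?sqr_ge0 // mulr_ge0 ?ler0n //.
have Tt : T^T = T by rewrite /T [(S - _)^T]raddfB /= St trmx1.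
have trQ : ip (Q - y) (Q *m T) = ip T (1%:M - Q^T *m y).
  by rewrite ipC ip_mull mulmxBr sR.
have trQ' : ip T (1%:M - Q^T *m y) = ip T (1%:M - y^T *m Q).
  by rewrite -ip_tr Tt [(1%:M - _)^T]raddfB /= trmx1 trmx_mul trmxK.
have := ip_diag_gram_ge0 U (Q - y) D0; rewrite -TE stiefel_gram // => H.
have : ip T (2%:R *: 1%:M - (Q^T *m y + y^T *m Q)) = 2%:R * ip T (1%:M - Q^T *m y).
  rewrite [RHS](_ : _ = ip T (1%:M - Q^T *m y) + ip T (1%:M - y^T *m Q)); last by rewrite -trQ'; ring.
  by rewrite !ip_expand; ring.
by rewrite trQ => E; rewrite E in H; lra.
Qed.

Lemma proj_tangent_tangent x y : stiefel x -> tangent x (proj_tangent x y).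
Proof.
move=> sx; rewrite /tangent /= /proj_tangent; set P := y^T *m x + x^T *m y.
have Pt : P^T = P by rewrite /P [(_ + _)^T]raddfD /= !trmx_mul !trmxK addrC.
rewrite mulmxBr [(y - _)^T]raddfB /= mulmxBl -scalemxAr [(_ *: _)^T]linearZ /= -scalemxAl.
rewrite trmx_mul Pt -mulmxA sx mulmx1 mulmxA sx mul1mx addrACA -/P -opprD -scalerDr.
rewrite -mulr2n -(scaler_nat 2 P) scalerA mulVf ?pnatr_eq0 // scale1r.
by rewrite /P [x^T *m y + _]addrC subrr.
Qed.

Lemma tangent_lin x a b (k l : R) : tangent x a -> tangent x b -> tangent x (k *: a + l *: b).
Proof.
rewrite /tangent /= => ta tb.
rewrite mulmxDr -!scalemxAr [(_ + _)^T]raddfD /= mulmxDl !linearZ /= -!scalemxAl addrACA.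
by rewrite -!scalerDr ta tb !scaler0 addr0.
Qed.

(** Tangency makes [x^T *m xi] skew, and a skew matrix is orthogonal to the symmetric [S]. *)
Lemma ip_tangent_normal x xi (S : 'M[R]_r) : tangent x xi -> S^T = S -> ip xi (x *m S) = 0.
Proof.
move=> tx Ss; have E1 : ip xi (x *m S) = ip S (x^T *m xi) by rewrite ipC ip_mull.
have E2 : ip S (x^T *m xi) = ip S (xi^T *m x) by rewrite -ip_tr Ss trmx_mul trmxK.
have : ip S (x^T *m xi + xi^T *m x) = 0 by rewrite tx ip0r.
by rewrite ipDr -E2 -E1; lra.
Qed.

Lemma ip_proj_tangent x xi y : tangent x xi -> ip xi (proj_tangent x y) = ip xi y.
Proof.
move=> tx; rewrite /proj_tangent !ip_expand ip_tangent_normal //; first by rewrite mulr0 subr0.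
by rewrite [(_ + _)^T]raddfD /= !trmx_mul !trmxK addrC.
Qed.

Lemma frob_proj_tangent x y : stiefel x -> frob (proj_tangent x y) <= frob y.
Proof.
move=> sx; have tx := proj_tangent_tangent y sx.
apply: frob_leP; first exact: frob_ge0.
rewrite frob_sqr; have := ip_proj_tangent y tx.
move: (proj_tangent x y) => p E; have := ip_ge0 (p - y); rewrite !ip_expand (ipC y) E; lra.
Qed.

Lemma proj_tangent_lin x a b (k l : R) :
  proj_tangent x (k *: a + l *: b) = k *: proj_tangent x a + l *: proj_tangent x b.
Proof.
rewrite /proj_tangent.
have -> : (k *: a + l *: b)^T *m x = k *: (a^T *m x) + l *: (b^T *m x).
  by rewrite [(_ + _)^T]raddfD /= [(k *: _)^T]linearZ [(l *: _)^T]linearZ /= mulmxDl -!scalemxAl.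
rewrite [x^T *m (_ + _)]mulmxDr -!scalemxAr addrACA -!scalerDr [x *m _]mulmxDr -!scalemxAr.
rewrite scalerDr opprD addrACA !scalerBr !scalerA.
by rewrite !(mulrC _ 2%:R^-1).
Qed.

Lemma proj_tangent_base x : stiefel x -> proj_tangent x x = 0.
Proof.
move=> sx; rewrite /proj_tangent sx mulmxDr mulmx1 -mulr2n -(scaler_nat 2 x) scalerA.
by rewrite mulVf ?pnatr_eq0 // scale1r subrr.
Qed.

(* First-order optimality along [s |-> polar_retr z (s *: xi)] forces the tangential part of [y] at [z] to vanish. *)
Lemma nearest_stiefel_normal (M : R) y z :
  (forall xi, tangent z xi -> frob (polar_retr z xi - (z + xi)) <= M * frob xi ^+ 2) ->
  nearest_stiefel y z -> proj_tangent z y = 0.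
Proof.
move=> HM [sz Hz]; set xi := proj_tangent z y.
have tx : tangent z xi by apply: proj_tangent_tangent.
have xiE : ip xi y = frob xi ^+ 2 by rewrite frob_sqr ip_proj_tangent.
move: xi tx xiE => xi tx xiE.
have tsx (s : R) : tangent z (s *: xi).
  by have := tangent_lin s 0 tx tx; rewrite scale0r addr0.
(* Points of the manifold have equal norm, so nearness means that moving along [s *: xi] cannot
   increase the inner product with [y]. The first-order gain [s |xi|^2] is therefore paid for by the
   quadratic retraction error. *)
have key (s : R) : 0 < s -> s * frob xi ^+ 2 <= M * s ^+ 2 * frob xi ^+ 2 * frob y.
  move=> s0; have sR := polar_stiefel sz (tsx s).
  have := Hz _ sR; rewrite -(@ler_sqr _ (frob _)) ?nnegrE ?frob_ge0 // => H1.
  rewrite !frob_sqrB !frob_sqr (ip_stiefel sR) (ip_stiefel sz) in H1.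
  have H2 : ip (polar_retr z (s *: xi)) y <= ip z y by lra.
  have H3 := HM _ (tsx s); rewrite frobZ exprMn real_normK ?num_real // in H3.
  have := ip_geN (polar_retr z (s *: xi) - (z + s *: xi)) y.
  rewrite ipDl ipNl ipDl ipZl xiE.
  have := ler_wpM2r (frob_ge0 y) H3.
  by nra.
have [/frob_eq0 //|x0] := eqVneq (frob xi) 0.
have xp : 0 < frob xi ^+ 2 by rewrite exprn_gt0 // lt_def x0 frob_ge0.
have y0 := frob_ge0 y.
(* With this step size the retraction error is at most half of the first-order gain, which
   contradicts [key] when [xi] is nonzero. *)
pose s := (2%:R * (`|M| * frob y + 1))^-1.
have c0 : 0 < `|M| * frob y + 1 by rewrite ltr_wpDl // mulr_ge0.
have s0 : 0 < s by rewrite invr_gt0 mulr_gt0.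
have sE : s * (`|M| * frob y + 1) = 2%:R^-1 by rewrite /s; field; rewrite gt_eqF.
have := key s s0.
rewrite (_ : M * s ^+ 2 * frob xi ^+ 2 * frob y = s * frob xi ^+ 2 * (s * M * frob y)); last by ring.
rewrite -[X in X <= _]mulr1 (ler_pM2l (mulr_gt0 s0 xp)) => H.
have : M * frob y <= `|M| * frob y by apply: ler_wpM2r => //; exact: ler_norm.
move=> /(ler_wpM2l (ltW s0)); rewrite mulrA => H'; exfalso.
move: sE; rewrite mulrDr mulr1; lra.
Qed.
End Retraction.

(** * Spectra of symmetric stochastic matrices *)

Section Eigenvalues.
Variable R : realType.

Lemma char_poly_orthogonal n (U : 'M[R]_n) (D : 'rV[R]_n) : U *m U^T = 1%:M ->
  char_poly (U^T *m diag_mx D *m U) = \prod_(i < n) ('X - (D 0 i)%:P).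
Proof.
move=> UU; have UtU := mulmx1C UU.
have -> : \prod_(i < n) ('X - (D 0 i)%:P) = char_poly (diag_mx D).
  rewrite char_poly_trig ?diag_mx_is_trig //.
  by apply: eq_bigr => i _; rewrite mxE eqxx mulr1n.
pose V := map_mx polyC U.
have VV : V^T *m V = 1%:M by rewrite /V map_trmx -map_mxM UtU map_mx1.
have VV' : V *m V^T = 1%:M by apply: mulmx1C.
rewrite /char_poly.
have -> : char_poly_mx (U^T *m diag_mx D *m U) = V^T *m char_poly_mx (diag_mx D) *m V.
  rewrite /char_poly_mx mulmxBr mulmxBl mul_mx_scalar -scalemxAl VV scalemx1.
  by rewrite !map_mxM -map_trmx.
by rewrite !det_mulmx mulrAC -det_mulmx VV det1 mul1r.
Qed.

(** The chosen sorted root list and the diagonal [D] both factor the characteristic polynomial, so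
    they are permutations of each other. [i0] and [j0] are the places of the two largest
    eigenvalues; when [n <= 1], [eig2] is the default value 0 of [nth]. *)
Lemma spectrum_decomposition n (A : 'M[R]_n) : A^T = A ->
  exists U : 'M[R]_n, exists D : 'rV[R]_n,
  [/\ U *m U^T = 1%:M, A = U^T *m diag_mx D *m U, forall i, eign A <= D 0 i,
    (n <= 1)%N -> eig2 A = 0 &
    (1 < n)%N -> exists i0 j0 : 'I_n, [/\ i0 != j0, D 0 j0 = eig2 A, eig2 A <= D 0 i0 &
      forall i, i != i0 -> D 0 i <= eig2 A]].
Proof.
move=> As; have [U [D [UU AE]]] := symmetric_spectral As.
exists U, D; pose t : n.-tuple R := [tuple D 0 i | i < n].
have cA : char_poly A = \prod_(z <- t) ('X - z%:P).
  rewrite AE char_poly_orthogonal // big_tuple.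
  by apply: eq_bigr => i _; rewrite tnth_mktuple.
have [ss cs] : sorted (>=%R) (spectrum A) /\ char_poly A = \prod_(z <- spectrum A) ('X - z%:P).
  apply: (@xgetPex _ [::] [set s : seq R | sorted (>=%R) s /\ char_poly A = \prod_(z <- s) ('X - z%:P)]).
  exists (sort (>=%R) t); split; first by apply: sort_sorted; exact: ge_total.
  rewrite cA; apply: perm_big; by rewrite perm_sym perm_sort.
have /tuple_permP [p sp] : perm_eq (spectrum A) t by apply: prod_XsubC_eq; rewrite -cs -cA.
have nthE (i : 'I_n) : nth 0 (spectrum A) i = D 0 (p i).
  by rewrite sp -tnth_nth !tnth_mktuple.
have szs : size (spectrum A) = n by rewrite sp size_tuple.
have mono i j : (i <= j < n)%N -> nth 0 (spectrum A) j <= nth 0 (spectrum A) i.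
  move=> /andP[ij jn]; apply: (sorted_leq_nth _ _ 0 ss) => //; rewrite ?inE ?szs //.
  - by move=> a b c /= ab bc; apply: le_trans bc ab.
  - by move=> a; exact: lexx.
  - exact: leq_ltn_trans ij jn.
have DE i : D 0 i = nth 0 (spectrum A) (p^-1%g i) by rewrite nthE permKV.
split=> // [i|n1|n1].
- rewrite DE; apply: mono; case: (p^-1%g i) => k kn /=.
  by have n0 := leq_ltn_trans (leq0n k) kn; rewrite ltn_predL n0 andbT -ltnS prednK.
- by rewrite /eig2 nth_default // szs.
pose i0 := Ordinal (ltnW n1); pose i1 := Ordinal n1.
exists (p i0), (p i1); rewrite (inj_eq perm_inj) -!nthE /=; split=> //.
  by apply: (mono 0%N 1%N); rewrite n1.
move=> i ii0; rewrite DE; apply: mono; rewrite ltn_ord andbT lt0n.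
by apply: contra ii0 => /eqP e; rewrite -(permKV p i); apply/eqP; congr (p _); apply: val_inj.
Qed.

Lemma ip_diag n m (U : 'M[R]_n) (D : 'rV[R]_n) (X : 'M[R]_(n, m)) :
  ip X (U^T *m diag_mx D *m U *m X) = \sum_i D 0 i * ip (row i (U *m X)) (row i (U *m X)).
Proof.
rewrite -!mulmxA -ip_mull ipE; apply: eq_bigr => i _.
rewrite ipE big_ord1 mulr_sumr; apply: eq_bigr => j _.
by rewrite mul_diag_mx !mxE; ring.
Qed.

Lemma ip_rows n m (X Y : 'M[R]_(n, m)) : ip X Y = \sum_i ip (row i X) (row i Y).
Proof.
rewrite ipE; apply: eq_bigr => i _; rewrite ipE big_ord1.
by apply: eq_bigr => j _; rewrite !mxE.
Qed.

Lemma ip_orthogonal n m (U : 'M[R]_n) (X : 'M[R]_(n, m)) : U *m U^T = 1%:M ->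
  ip (U *m X) (U *m X) = ip X X.
Proof. by move=> /mulmx1C UU; rewrite ip_mull mulmxA UU mul1mx. Qed.

Lemma eign_form n m (A : 'M[R]_n) (X : 'M[R]_(n, m)) : A^T = A ->
  eign A * ip X X <= ip X (A *m X).
Proof.
move=> As; have [U [D [UU AE nD _ _]]] := spectrum_decomposition As.
rewrite [in leRHS]AE ip_diag -(ip_orthogonal X UU) [X in _ * X]ip_rows mulr_sumr.
by apply: ler_sum => i _; apply: ler_wpM2r => //; exact: ip_ge0.
Qed.

Section Stochastic.
Variables (n : nat).
Definition sym_stochastic (A : 'M[R]_n) :=
  [/\ A^T = A, forall i j, 0 <= A i j & forall i, \sum_j A i j = 1].
Variable A : 'M[R]_n.
Hypothesis SA : sym_stochastic A.

Let As : A^T = A. Proof. by case: SA. Qed.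
Let A0 i j : 0 <= A i j. Proof. by case: SA. Qed.
Let A1 i : \sum_j A i j = 1. Proof. by case: SA. Qed.
Let A1' j : \sum_i A i j = 1.
Proof. by rewrite -(A1 j); apply: eq_bigr => i _; rewrite -[in RHS]As mxE. Qed.

(** The Dirichlet form of the graph Laplacian [1 - A]: since rows and columns sum to 1, the squares
    in the expansion lose their weights. *)
Lemma dirichlet m p (x : 'I_n -> 'M[R]_(m, p)) :
  \sum_i \sum_j A i j * frob (x i - x j) ^+ 2 =
  2%:R * (\sum_i frob (x i) ^+ 2 - \sum_i ip (x i) (\sum_j A i j *: x j)).
Proof.
transitivity (\sum_i \sum_j (A i j * frob (x i) ^+ 2 + A i j * frob (x j) ^+ 2 - 2%:R * (A i j * ip (x i) (x j)))).
  by do 2!apply: eq_bigr => ? _; rewrite frob_sqrB; ring.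
under eq_bigr => i _ do rewrite sumrB big_split /= -mulr_suml A1 mul1r -mulr_sumr.
rewrite sumrB big_split /= -mulr_sumr [X in _ + X - _]exchange_big /=.
under [X in _ + X - _]eq_bigr => j _ do rewrite -mulr_suml A1' mul1r.
have -> : \sum_i ip (x i) (\sum_j A i j *: x j) = \sum_i \sum_j A i j * ip (x i) (x j).
  by apply: eq_bigr => i _; rewrite ip_sumr; apply: eq_bigr => j _; rewrite ipZr.
ring.
Qed.

Lemma dirichlet_ge0 m p (x : 'I_n -> 'M[R]_(m, p)) :
  0 <= \sum_i \sum_j A i j * frob (x i - x j) ^+ 2.
Proof. by do 2!apply: sumr_ge0 => ? _; rewrite mulr_ge0 ?sqr_ge0. Qed.

(** Each block is flattened to a row, so that the Kronecker action of [A] on the stacked variable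
    becomes left multiplication by [A]. *)
Definition stack m p (x : 'I_n -> 'M[R]_(m, p)) : 'M[R]_(n, m * p) := \matrix_(i < n) mxvec (x i).

Lemma ip_mxvec m p (a b : 'M[R]_(m, p)) : ip (mxvec a) (mxvec b) = ip a b.
Proof.
rewrite !ipE big_ord1 pair_big (reindex _ (curry_mxvec_bij _ _)) /=.
by apply: eq_bigr => -[i j] _; rewrite !mxvecE.
Qed.

Lemma row_stack m p (x : 'I_n -> 'M[R]_(m, p)) i : row i (stack x) = mxvec (x i).
Proof. exact: rowK. Qed.

Lemma mul_stack m p (x : 'I_n -> 'M[R]_(m, p)) : A *m stack x = stack (fun i => \sum_j A i j *: x j).
Proof.
apply/row_matrixP => i; rewrite row_stack row_mul mulmx_sum_row linear_sum /=.
by apply: eq_bigr => j _; rewrite row_stack mxE linearZ.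
Qed.

Lemma ip_stack m p (x y : 'I_n -> 'M[R]_(m, p)) : ip (stack x) (stack y) = \sum_i ip (x i) (y i).
Proof. by rewrite ip_rows; apply: eq_bigr => i _; rewrite !row_stack ip_mxvec. Qed.

Lemma frob_stack m p (x : 'I_n -> 'M[R]_(m, p)) : frob (stack x) ^+ 2 = \sum_i frob (x i) ^+ 2.
Proof. by rewrite frob_sqr ip_stack; apply: eq_bigr => i _; rewrite frob_sqr. Qed.

End Stochastic.
End Eigenvalues.

(** * Spectral gap of symmetric stochastic matrices *)

Section Mixing.
Variables (R : realType) (n : nat).
Implicit Types A W : 'M[R]_n.

Lemma sym_stochastic_mul1 A : sym_stochastic A -> A *m (const_mx 1 : 'cV_n) = const_mx 1.
Proof.
case=> _ _ A1; apply/matrixP => i j; rewrite !mxE -[RHS](A1 i).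
by apply: eq_bigr => k _; rewrite mxE mulr1.
Qed.

Lemma dirichlet_mx m A (X : 'M[R]_(n, m)) : sym_stochastic A ->
  \sum_i \sum_j A i j * frob (row i X - row j X) ^+ 2 = 2%:R * (ip X X - ip X (A *m X)).
Proof.
move=> SA; rewrite dirichlet //; congr (_ * (_ - _)).
  by rewrite [RHS]ip_rows; apply: eq_bigr => i _; rewrite frob_sqr.
by rewrite [RHS]ip_rows; apply: eq_bigr => i _; rewrite row_mul mulmx_sum_row; congr ip; apply: eq_bigr => j _; rewrite mxE.
Qed.

Lemma stochastic_form_le m A (X : 'M[R]_(n, m)) : sym_stochastic A -> ip X (A *m X) <= ip X X.
Proof.
move=> SA; have := dirichlet_ge0 SA (fun i => row i X); rewrite dirichlet_mx //; lra.
Qed.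

Lemma sym_stochasticM A B : sym_stochastic A -> sym_stochastic B -> A *m B = B *m A ->
  sym_stochastic (A *m B).
Proof.
move=> [As A0 A1] [Bs B0 B1] AB; split.
- by rewrite trmx_mul As Bs.
- by move=> i j; rewrite mxE; apply: sumr_ge0 => k _; rewrite mulr_ge0.
- move=> i; under eq_bigr => j _ do rewrite mxE.
  rewrite exchange_big /= -[RHS](A1 i); apply: eq_bigr => k _.
  by rewrite -mulr_sumr B1 mulr1.
Qed.

(** The left side is the quadratic form of [A *m A], which is again symmetric and stochastic. *)
Lemma stochastic_contract m A (X : 'M[R]_(n, m)) : sym_stochastic A ->
  ip (A *m X) (A *m X) <= ip X X.
Proof.
move=> SA; have [As _ _] := SA.
by have := stochastic_form_le X (sym_stochasticM SA SA erefl); rewrite ip_mull As mulmxA.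
Qed.

Lemma eign_le1 A : (0 < n)%N -> sym_stochastic A -> eign A <= 1.
Proof.
move=> n0 SA; have As : A^T = A by case: SA.
have := eign_form (const_mx 1 : 'cV[R]_n) As.
rewrite sym_stochastic_mul1 //.
have -> : ip (const_mx 1 : 'cV[R]_n) (const_mx 1) = n%:R.
  rewrite ipE (eq_bigr (fun=> 1)) => [|i _]; last by rewrite big_ord1 !mxE mulr1.
  by rewrite sumr_const card_ord.
by rewrite -ler_pdivlMr ?ltr0n // divff // pnatr_eq0 -lt0n.
Qed.

(** If [eig2 A >= 1] the bound follows from [stochastic_form_le]. Otherwise the constant vector,
    fixed by [A], must span the top eigendirection [i0]; being orthogonal to constants, [X] has no
    component there, and all other eigenvalues are at most [eig2 A]. *)
Lemma eig2_form m A (X : 'M[R]_(n, m)) : sym_stochastic A ->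
  (const_mx 1 : 'rV_n) *m X = 0 -> ip X (A *m X) <= eig2 A * ip X X.
Proof.
move=> SA X1; have As : A^T = A by case: SA.
have [n1|n1] := leqP n 1.
  suff -> : X = 0 by rewrite mulmx0 !ip0r mulr0.
  apply/matrixP => i j; have := congr1 (fun Y : 'rV[R]_m => Y 0 j) X1.
  rewrite !mxE (bigD1 i) //= big1 => [|k /eqP ki].
    by rewrite mxE mul1r addr0.
  case: ki; apply: val_inj; case: k i => [k kn] [i ni] /=.
  by have := leq_trans kn n1; have := leq_trans ni n1; rewrite !ltnS !leqn0 => /eqP -> /eqP ->.
have [A2|A2] := leP 1 (eig2 A).
  apply: le_trans (stochastic_form_le X SA) _.
  by rewrite -[leLHS]mul1r; apply: ler_wpM2r => //; exact: ip_ge0.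
have [U [D [UU AE _ _ /(_ n1) [i0 [j0 [_ _ _ Di]]]]]] := spectrum_decomposition As.
pose w : 'cV[R]_n := U *m const_mx 1.
have Dw : diag_mx D *m w = w.
  rewrite /w -[in RHS](sym_stochastic_mul1 SA) [in RHS]AE !mulmxA UU mul1mx //.
(* [w] is fixed by [diag_mx D], while every entry of [D] other than the one at [i0] is below 1. *)
have w0 i : i != i0 -> w i 0 = 0.
  move=> ii0; have := congr1 (fun M : 'cV[R]_n => M i 0) Dw; rewrite mul_diag_mx mxE => e.
  have : (1 - D 0 i) * w i 0 = 0 by rewrite mulrBl mul1r e subrr.
  by move/eqP; rewrite mulf_eq0 subr_eq0 gt_eqF ?(le_lt_trans (Di i ii0)) //= => /eqP.
have wi0 : w i0 0 != 0.
  apply/eqP => w00; have : ip w w = 0.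
    rewrite ipE big1 // => i _; rewrite big_ord1.
    by have [->|/w0 ->] := eqVneq i i0; rewrite ?w00 mul0r.
  rewrite /w ip_orthogonal // ipE => /eqP; apply/negP.
  rewrite (eq_bigr (fun=> 1)) => [|i _]; last by rewrite big_ord1 !mxE mulr1.
  by rewrite sumr_const card_ord pnatr_eq0 -lt0n ltnW.
have row0 : row i0 (U *m X) = 0.
  have e : w^T *m (U *m X) = 0.
    by rewrite /w trmx_mul mulmxA -(mulmxA _ U^T) (mulmx1C UU) mulmx1 trmx_const.
  apply/rowP => j; have := congr1 (fun M : 'rV[R]_m => M 0 j) e.
  rewrite [LHS]mxE [RHS]mxE (bigD1 i0) //= big1 => [|i ii0]; last by rewrite [_^T _ _]mxE w0 // mul0r.
  rewrite addr0 [_^T _ _]mxE => /eqP; rewrite mulf_eq0 (negPf wi0) /= => /eqP h.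
  by rewrite [LHS]mxE h mxE.
rewrite [in leLHS]AE ip_diag -(ip_orthogonal X UU) [X in _ <= _ * X]ip_rows mulr_sumr.
apply: ler_sum => i _; have [->|ii0] := eqVneq i i0; first by rewrite row0 !ip0r !mulr0.
by apply: ler_wpM2r; [exact: ip_ge0|exact: Di].
Qed.

Lemma mxpow_comm W t : W *m mxpow W t = mxpow W t *m W.
Proof.
elim: t => [|t IH]; first by rewrite /mxpow /= mulmx1 mul1mx.
have E : mxpow W t.+1 = W *m mxpow W t by [].
by rewrite E -[RHS]mulmxA -IH.
Qed.

Lemma sym_stochastic_mxpow W t : sym_stochastic W -> sym_stochastic (mxpow W t).
Proof.
move=> SW; elim: t => [|t IH]; last by apply: sym_stochasticM => //; exact: mxpow_comm.
split; first by rewrite trmx1.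
- by move=> i j; rewrite mxE; case: (_ == _); rewrite ?ler01.
- move=> i; rewrite (bigD1 i) //= big1 => [|j /negPf ji]; rewrite mxE ?eqxx ?addr0 //.
  by rewrite eq_sym ji.
Qed.

(* If two eigenvalues were [>= 1], both eigenvectors would have zero Dirichlet energy,
   hence be constant by connectedness, contradicting orthogonality. *)
Lemma sing2_lt1 W (G : rel 'I_n) : sym_stochastic W -> (forall i j, connect G i j) ->
  (forall i, 0 < W i i) -> (forall i j, G i j -> 0 < W i j) -> sing2 W < 1.
Proof.
move=> SW GC W0 WG; have [Ws Wp W1] := SW.
rewrite /sing2 Ws; set A := W *m W; have SA : sym_stochastic A by apply: sym_stochasticM.
have [As _ A1] := SA.
rewrite -[X in _ < X]sqrtr1 ltr_sqrt // ltNge; apply/negP => A2.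
have [U [D [UU AE _ n0 n1]]] := spectrum_decomposition As.
case: (leqP n 1) => [/n0 e|/n1]; first by rewrite e ler10 in A2.
move=> [i0 [j0 [ij Dj Di _]]].
(* The positive diagonal of [W] keeps the edges of [G] in the square: the entry contains the term
   [W i i * W i j]. *)
have AG i j : G i j -> 0 < A i j.
  move=> Gij; rewrite mxE (bigD1 i) //=; apply: ltr_wpDr.
    by apply: sumr_ge0 => k _; rewrite mulr_ge0.
  by apply: mulr_gt0; [exact: W0|exact: WG].
(* An eigenvalue at least 1 makes the Dirichlet sum nonpositive. All its terms are nonnegative, so
   the eigenvector agrees across every edge and hence along every path. *)
have cst k : 1 <= D 0 k -> forall i j, U k i = U k j.
  move=> Dk; pose X : 'cV[R]_n := (row k U)^T.
  have AX : A *m X = D 0 k *: X.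
    have AU : A *m U^T = U^T *m diag_mx D by rewrite [in LHS]AE -!mulmxA UU mulmx1.
    apply/colP => i; transitivity ((A *m U^T) i k).
      rewrite [LHS]mxE [RHS]mxE; apply: eq_bigr => l _.
      by rewrite ![_^T _ _]mxE [row _ _ _ _]mxE.
    by rewrite AU mul_mx_diag [LHS]mxE [RHS]mxE ![_^T _ _]mxE [row _ _ _ _]mxE mulrC.
  have E0 : \sum_i \sum_j A i j * frob (row i X - row j X) ^+ 2 <= 0.
    rewrite dirichlet_mx // AX ipZr -{1}[ip X X]mul1r -mulrBl.
    by rewrite pmulr_rle0 // mulr_le0_ge0 ?subr_le0 ?ip_ge0.
  have T0 i j : 0 <= A i j * frob (row i X - row j X) ^+ 2 by case: SA => _ Ap _; rewrite mulr_ge0 ?sqr_ge0.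
  have edge i j : G i j -> U k i = U k j.
    move=> /AG Aij; have : A i j * frob (row i X - row j X) ^+ 2 <= 0.
      apply: le_trans E0; rewrite (bigD1 i) //= (bigD1 j) //= -addrA lerDl addr_ge0 //.
        by apply: sumr_ge0.
      by do 2!apply: sumr_ge0 => ? _.
    rewrite pmulr_rle0 // => h; have /eqP : frob (row i X - row j X) ^+ 2 == 0.
      by rewrite eq_le h sqr_ge0.
    move/eqP; rewrite sqrf_eq0 => /eqP /frob_eq0 /rowP /(_ 0).
    by rewrite !mxE => /eqP; rewrite subr_eq0 => /eqP.
  move=> i j; have /connectP [p pp ->] := GC i j.
  elim: p i pp {j} => //= a p IH i /andP[/edge -> /IH //].
have gram k l : \sum_i U k i * U l i = (k == l)%:R.
  by have := congr1 (fun M : 'M[R]_n => M k l) UU; rewrite !mxE => <-; apply: eq_bigr => i _; rewrite mxE.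
have ci := cst i0 (le_trans A2 Di); have cj : forall i j, U j0 i = U j0 j by apply: cst; rewrite Dj.
have gramc k l : (forall i j, U k i = U k j) -> (forall i j, U l i = U l j) ->
    n%:R * (U k i0 * U l i0) = (k == l)%:R.
  move=> ck cl; rewrite -gram (eq_bigr (fun=> U k i0 * U l i0)) => [|i _].
    by rewrite sumr_const card_ord mulr_natl.
  by rewrite (ck i i0) (cl i i0).
have h1 := gramc i0 i0 ci ci; have h2 := gramc j0 j0 cj cj; have h3 := gramc i0 j0 ci cj.
rewrite !eqxx in h1 h2; rewrite (negPf ij) in h3.
(* For constant rows the product of the squared norms equals the square of the inner product, so
   orthonormality would give 1 = 0. *)
have : (n%:R * (U i0 i0 * U i0 i0)) * (n%:R * (U j0 i0 * U j0 i0)) = (n%:R * (U i0 i0 * U j0 i0)) ^+ 2 by ring.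
by rewrite h1 h2 h3 mulr1 expr0n => /eqP; rewrite oner_eq0.
Qed.
End Mixing.

(** * Convergence of powers to the averaging matrix, and the Laplacian energy *)

Section Mixing.
Variables (R : realType) (n : nat).
Implicit Types A W : 'M[R]_n.

Lemma sing2_contract m W (X : 'M[R]_(n, m)) : sym_stochastic W ->
  (const_mx 1 : 'rV_n) *m X = 0 -> frob (W *m X) <= sing2 W * frob X.
Proof.
move=> SW X1; have [Ws _ _] := SW.
apply: frob_leP; first by rewrite mulr_ge0 ?sqrtr_ge0 ?frob_ge0.
rewrite ip_mull mulmxA exprMn frob_sqr Ws.
apply: le_trans (eig2_form (sym_stochasticM SW SW erefl) X1) _.
apply: ler_wpM2r; first exact: ip_ge0.
(* [Num.sqrt] sends a negative argument to 0, and a negative [eig2] lies below that square as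
   well. *)
rewrite /sing2 Ws; have [e0|e0] := leP 0 (eig2 (W *m W)); first by rewrite sqr_sqrtr.
by rewrite (le_trans (ltW e0)) // sqr_ge0.
Qed.

Lemma sing2_contract_iter m W t (X : 'M[R]_(n, m)) : sym_stochastic W ->
  (const_mx 1 : 'rV_n) *m X = 0 ->
  frob (mxpow W t *m X) <= sing2 W ^+ t * frob X.
Proof.
move=> SW X1.
have one A : sym_stochastic A -> (const_mx 1 : 'rV[R]_n) *m A = const_mx 1.
  move=> SA; have [As _ _] := SA; apply: trmx_inj.
  by rewrite trmx_mul As trmx_const sym_stochastic_mul1.
elim: t => [|t IH]; first by rewrite mul1mx expr0 mul1r.
have -> : mxpow W t.+1 *m X = W *m (mxpow W t *m X) by rewrite mulmxA.
apply: le_trans (sing2_contract SW _) _.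
  by rewrite mulmxA (one _ (sym_stochastic_mxpow t SW)).
by rewrite exprS -mulrA ler_wpM2l ?sqrtr_ge0.
Qed.

Lemma sum_norm_le_frob (v : 'cV[R]_n) : \sum_i `|v i 0| <= Num.sqrt n%:R * frob v.
Proof.
have := ip_le (const_mx 1 : 'cV[R]_n) (\col_i `|v i 0|).
rewrite ipE (eq_bigr (fun i => `|v i 0|)) => [h|i _]; last by rewrite big_ord1 !mxE mul1r.
apply: le_trans h _; rewrite le_eqVlt; apply/orP; left; apply/eqP; congr (_ * _).
  rewrite /frob ipE (eq_bigr (fun=> 1)) => [|i _]; last by rewrite big_ord1 !mxE mulr1.
  by rewrite sumr_const card_ord.
rewrite /frob !ipE; congr Num.sqrt; apply: eq_bigr => i _; rewrite !big_ord1 !mxE.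
by rewrite -normrM ger0_norm // -expr2 sqr_ge0.
Qed.

(** The row in question is [mxpow W t] applied to the mean-zero vector [X], a basis vector minus its
    average, whose norm is at most 1. The factor [sqrt n] passes from the Euclidean to the l1
    norm. *)
Lemma mxpow_row_l1 W t i : sym_stochastic W ->
  \sum_j `|mxpow W t i j - n%:R^-1| <= Num.sqrt n%:R * sing2 W ^+ t.
Proof.
move=> SW; have SWt := sym_stochastic_mxpow t SW; have [Wts _ _] := SWt.
have n0 : (n%:R : R) != 0 by rewrite pnatr_eq0; case: n i => [[]|].
pose X : 'cV[R]_n := delta_mx i 0 - n%:R^-1 *: const_mx 1.
have Xsum : \sum_j X j 0 = 0.
  rewrite (eq_bigr (fun j => (j == i)%:R - n%:R^-1)) => [|j _]; last by rewrite !mxE andbT mulr1.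
  rewrite sumrB sumr_const card_ord -[_^-1 *+ n]mulr_natl divff // (bigD1 i) //= big1 => [|j /negPf ->//].
  by rewrite eqxx addr0 subrr.
have X1 : (const_mx 1 : 'rV[R]_n) *m X = 0.
  apply/matrixP => a b; rewrite (ord1 a) (ord1 b) [LHS]mxE [RHS]mxE -[RHS]Xsum.
  by apply: eq_bigr => j _; rewrite [const_mx _ _ _]mxE mul1r.
have fX : frob X <= 1.
  apply: frob_leP => //; rewrite expr1n.
  have ipX Y : ip X Y = ip (delta_mx i 0) Y - n%:R^-1 * ip (const_mx 1) Y.
    by rewrite /X ipDl ipNl ipZl.
  rewrite ipX.
  have -> : ip (const_mx 1 : 'cV[R]_n) X = 0.
    by rewrite /frob_inner trmx_const X1 mxtrace0.
  rewrite mulr0 subr0 /frob_inner trmx_delta -rowE trace_mx11 !mxE !eqxx /= mulr1.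
  by rewrite lerBlDr lerDl invr_ge0.
have := sum_norm_le_frob (mxpow W t *m X).
rewrite (eq_bigr (fun j => `|mxpow W t i j - n%:R^-1|)) => [h|j _].
  apply: le_trans h _; apply: ler_wpM2l; first exact: sqrtr_ge0.
  apply: le_trans (sing2_contract_iter t SW X1) _.
  by rewrite ler_piMr // exprn_ge0 // sqrtr_ge0.
rewrite /X mulmxBr -scalemxAr sym_stochastic_mul1 // -colE.
by rewrite [in LHS]mxE [col _ _ _ _]mxE [X in _ + X]mxE [X in - X]mxE [const_mx _ _ _]mxE mulr1 -[in LHS]Wts mxE.
Qed.

Lemma mxpow_row_l1_half W t i : (1 <= t)%N -> sym_stochastic W -> sing2 W < 1 ->
  (Num.ceil (logb (sing2 W) (2%:R * Num.sqrt n%:R)^-1) <= t%:Z)%R ->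
  \sum_j `|mxpow W t i j - n%:R^-1| <= 2%:R^-1.
Proof.
move=> t1 SW s1 Ht; apply: le_trans (mxpow_row_l1 t i SW) _.
have n0 : 0 < Num.sqrt n%:R :> R by rewrite sqrtr_gt0 ltr0n; case: n i => [[]|].
have s0 : 0 <= sing2 W by exact: sqrtr_ge0.
suff H : sing2 W ^+ t <= (2%:R * Num.sqrt n%:R)^-1.
  apply: le_trans (ler_wpM2l (ltW n0) H) _.
  by rewrite invfM mulrCA divff ?mulr1 // gt_eqF.
have c0 : 0 < (2%:R * Num.sqrt n%:R)^-1 :> R by rewrite invr_gt0 mulr_gt0.
(* At [sing2 W = 0] the logarithm is a default value; there [1 <= t] makes the power vanish. *)
have [e|e] := eqVneq (sing2 W) 0; first by rewrite e expr0n -[t]prednK //= ltW.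
have sp : 0 < sing2 W by rewrite lt_def e.
have ln0 : ln (sing2 W) < 0 by apply: ln_lt0; rewrite sp s1.
have : logb (sing2 W) (2%:R * Num.sqrt n%:R)^-1 <= t%:R.
  by apply: le_trans (ceil_ge _) _; rewrite -[t%:R]/(t%:Z%:~R) ler_int.
rewrite /logb ler_ndivrMr // => H.
rewrite -ler_ln ?posrE ?exprn_gt0 // lnXn //.
by rewrite -[_ *+ t]mulr_natl.
Qed.

Section Families.
Variables (m p : nat) (A : 'M[R]_n).
Hypothesis SA : sym_stochastic A.
Hypothesis n0 : (0 < n)%N.
Implicit Types x : 'I_n -> 'M[R]_(m, p).

Definition energy x : R := 2%:R^-1 * \sum_i \sum_j A i j * frob (x i - x j) ^+ 2.

Lemma energy_ge0 x : 0 <= energy x.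
Proof. by rewrite mulr_ge0 ?invr_ge0 // dirichlet_ge0. Qed.

Lemma energy_stack x : energy x = ip (stack x) (stack x) - ip (stack x) (A *m stack x).
Proof.
rewrite /energy dirichlet // mulKf ?pnatr_eq0 // mul_stack !ip_stack.
by congr (_ - _); apply: eq_bigr => i _; rewrite frob_sqr.
Qed.

Lemma energy_ip x : \sum_i ip (x i) (x i - \sum_j A i j *: x j) = energy x.
Proof.
rewrite energy_stack mul_stack !ip_stack -sumrB.
by apply: eq_bigr => i _; rewrite !ip_expand.
Qed.

Lemma energy_translate x a : energy (fun i => x i - a) = energy x.
Proof.
by congr (_ * _); do 2!apply: eq_bigr => ? _; rewrite opprB addrA subrK.
Qed.

(** The energy ignores translations; after subtracting the mean the stacked family is orthogonal to
    constants, where [eig2_form] applies. *)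
Lemma energy_gap x : (1 - eig2 A) * \sum_i frob (x i - n%:R^-1 *: \sum_j x j) ^+ 2 <= energy x.
Proof.
set h := _ *: _; rewrite -(energy_translate x h).
pose y i := x i - h; rewrite -/y energy_stack.
have -> : \sum_i frob (y i) ^+ 2 = ip (stack y) (stack y).
  by rewrite -frob_sqr frob_stack.
have y0 : (const_mx 1 : 'rV[R]_n) *m stack y = 0.
  have sy : \sum_i y i = 0.
    rewrite sumrB sumr_const card_ord -(scaler_nat n h) scalerA divff ?pnatr_eq0 -?lt0n //.
    by rewrite scale1r subrr.
  rewrite mulmx_sum_row (eq_bigr (fun i => mxvec (y i))) => [|i _]; last by rewrite mxE scale1r row_stack.
  by rewrite -linear_sum sy linear0.
have := eig2_form SA y0; lra.
Qed.

(** For the psd operator [B = 1 - A] with norm at most [a = 1 - eign A], this is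
    [|B X|^2 <= a <X, B X>]. The form of [B] at [X - s *: B X] is a nonnegative quadratic in [s];
    the choice [s = 1 / a] gives the bound. *)
Lemma energy_smooth x :
  \sum_i frob (x i - \sum_j A i j *: x j) ^+ 2 <= (1 - eign A) * energy x.
Proof.
have l0 := eign_le1 n0 SA; have [As _ _] := SA.
pose X := stack x; pose Y := X - A *m X.
have -> : \sum_i frob (x i - \sum_j A i j *: x j) ^+ 2 = ip Y Y.
  have -> : Y = stack (fun i => x i - \sum_j A i j *: x j).
    by rewrite /Y mul_stack; apply/row_matrixP => i; rewrite [LHS]raddfB /= !row_stack [RHS]raddfB.
  by rewrite -frob_sqr frob_stack.
have -> : energy x = ip X Y by rewrite energy_stack ipDr ipNr.
have sq (s : R) : 0 <= ip X Y - 2%:R * s * ip Y Y + s ^+ 2 * ((1 - eign A) * ip Y Y).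
  have h1 := eign_form Y As.
  have XA : ip X (A *m Y) = ip X Y - ip Y Y.
    have AX : A *m X = X - Y by rewrite /Y opprB addrCA subrr addr0.
    by rewrite ipC ip_mull As AX; move: (Y) => Z; rewrite ipDr ipNr (ipC Z X).
  have := stochastic_form_le (X - s *: Y) SA.
  have -> : A *m (X - s *: Y) = X - Y - s *: (A *m Y).
    by rewrite mulmxBr -scalemxAr {2}/Y opprB addrCA subrr addr0.
  move: XA h1; move: (A *m Y) => Z XA h1; move: Y XA h1 => Y' XA h1.
  rewrite !ip_expand XA (ipC Y' X) => h2.
  have s2 : 0 <= s ^+ 2 by rewrite sqr_ge0.
  have := ler_wpM2l s2 h1; nra.
have P0 := ip_ge0 Y; have q0 : 0 <= ip X Y.
  by have := sq 0; rewrite expr0n /= !(mulr0, mul0r) subr0 addr0.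
move: (ip X Y) (ip Y Y) P0 q0 sq => q P P0 q0 sq.
have [l|l] := ltP 0 (1 - eign A).
  have := mulr_ge0 (ltW l) (sq (1 - eign A)^-1).
  set a := 1 - eign A in l *; move=> h.
  have e : a * (q - 2%:R * a^-1 * P + a^-1 ^+ 2 * (a * P)) = a * q - P.
    by field; rewrite gt_eqF.
  by rewrite e in h; lra.
(* Without its [s ^ 2] term the quadratic is affine in [s], and a positive [P] would make it
   negative at the witness below. *)
have e : 1 - eign A = 0 by lra.
rewrite e mul0r; rewrite e in sq.
rewrite leNgt; apply/negP => Pp.
have := sq ((q + 1) / (2%:R * P)).
rewrite mul0r mulr0 addr0 (_ : 2%:R * _ * P = q + 1); first lra.
by field; rewrite gt_eqF.
Qed.
End Families.
End Mixing.

(** * Means of points of the Stiefel manifold *)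

Section Mean.
Variables (R : realType) (n d r : nat).
Hypothesis n0 : (0 < n)%N.
Implicit Types (x : 'I_n -> 'M[R]_(d, r)) (y z : 'M[R]_(d, r)).

Definition mean x : 'M[R]_(d, r) := n%:R^-1 *: \sum_i x i.
Definition gram m p (a : 'M[R]_(m, p)) : 'M[R]_p := a^T *m a.

Let nn0 : (n%:R : R) != 0. Proof. by rewrite pnatr_eq0 -lt0n. Qed.
Let np : 0 < (n%:R : R). Proof. by rewrite ltr0n. Qed.

Lemma gram_sym m p (a : 'M[R]_(m, p)) : (gram a)^T = gram a.
Proof. by rewrite /gram trmx_mul trmxK. Qed.

Lemma frob_gram m p (a : 'M[R]_(m, p)) : frob (gram a) <= frob a ^+ 2.
Proof. by apply: le_trans (frob_mul _ _) _; rewrite frob_tr expr2. Qed.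

(** Only the symmetric part of [1 - y^T z] pairs with [S], and it is half of [gram (y - z)]. This is
    how normal directions see differences only to second order. *)
Lemma ip_stiefel_gram y z (S : 'M[R]_r) : stiefel y -> stiefel z -> S^T = S ->
  ip (y - z) (y *m S) = 2%:R^-1 * ip (gram (y - z)) S.
Proof.
move=> sy sz Ss; rewrite /gram stiefel_gram //.
have -> : ip (y - z) (y *m S) = ip (1%:M - y^T *m z) S by rewrite ipC ip_mull mulmxBr sy ipC.
have : ip (1%:M - y^T *m z) S = ip (1%:M - z^T *m y) S.
  by rewrite -ip_tr Ss [(1%:M - _)^T]raddfB /= trmx1 trmx_mul trmxK.
by rewrite !ip_expand => h; lra.
Qed.

(** The relative amount by which averaging pulls the mean off the manifold: [mean_polar] reads
    [mean x = y (1 - dispersion x y)]. *)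
Definition dispersion x y : 'M[R]_r := (2%:R * n%:R)^-1 *: \sum_i gram (x i - y).

Lemma dispersion_sym x y : (dispersion x y)^T = dispersion x y.
Proof.
rewrite /dispersion linearZ /= raddf_sum; congr (_ *: _).
by apply: eq_bigr => i _; rewrite /= gram_sym.
Qed.

Lemma frob_dispersion x y : frob (dispersion x y) <= (2%:R * n%:R)^-1 * \sum_i frob (x i - y) ^+ 2.
Proof.
rewrite /dispersion frobZ ger0_norm ?invr_ge0 ?mulr_ge0 ?ler0n //.
apply: ler_wpM2l; first by rewrite invr_ge0 mulr_ge0 ?ler0n.
by apply: le_trans (frob_sum _ _ _) _; apply: ler_sum => i _; exact: frob_gram.
Qed.

(** A vanishing tangential part leaves [mean x = y P / 2], and averaging [stiefel_gram] over the
    points identifies [1 - P / 2] with the dispersion. *)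
Lemma mean_polar x y : (forall i, stiefel (x i)) -> stiefel y ->
  proj_tangent y (mean x) = 0 -> mean x = y - y *m dispersion x y.
Proof.
move=> sx sy /eqP; rewrite subr_eq0 => /eqP ->.
set P := (mean x)^T *m y + y^T *m mean x.
suff -> : dispersion x y = 1%:M - 2%:R^-1 *: P.
  by rewrite mulmxBr mulmx1 -scalemxAr opprB addrCA subrr addr0.
have sP : \sum_i ((x i)^T *m y + y^T *m x i) = n%:R *: P.
  rewrite big_split /= -mulmx_suml -mulmx_sumr /P /mean [(_ *: _)^T]linearZ /= [(\sum_i x i)^T]raddf_sum /=.
  by rewrite -scalemxAl -scalemxAr -scalerDr scalerA divff // scale1r.
rewrite /dispersion (eq_bigr (fun i => 2%:R *: 1%:M - ((x i)^T *m y + y^T *m x i))) => [|i _].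
  rewrite sumrB sumr_const card_ord sP -(scaler_nat n (2%:R *: 1%:M)) scalerBr !scalerA.
  by congr (_ - _ *: _); [rewrite -[RHS]scale1r; congr (_ *: _); field|field].
exact: stiefel_gram.
Qed.

Lemma frob_mean x y : (forall i, stiefel (x i)) -> stiefel y -> proj_tangent y (mean x) = 0 ->
  frob (mean x - y) <= (2%:R * n%:R)^-1 * \sum_i frob (x i - y) ^+ 2.
Proof.
move=> sx sy h; rewrite (mean_polar sx sy h) addrAC subrr sub0r frobN frob_stiefel_mul //.
exact: frob_dispersion.
Qed.

(** For [w] on the manifold the sum of squared distances is affine in [ip (mean x) w], so the point
    nearest to the mean also minimises that sum. *)
Lemma nearest_mean_le x y z : (forall i, stiefel (x i)) -> nearest_stiefel (mean x) y ->
  stiefel z -> \sum_i frob (x i - y) ^+ 2 <= \sum_i frob (x i - z) ^+ 2.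
Proof.
move=> sx [sy Hy] sz.
have E w : stiefel w -> \sum_i frob (x i - w) ^+ 2 = n%:R * (2%:R * r%:R - 2%:R * ip (mean x) w).
  move=> sw; rewrite (eq_bigr (fun i => 2%:R * r%:R - 2%:R * ip (x i) w)) => [|i _].
    rewrite sumrB sumr_const card_ord -mulr_sumr -ip_suml /mean ipZl.
    by rewrite -[_ *+ n]mulr_natl; field.
  by rewrite frob_sqrB !frob_sqr (ip_stiefel (sx i)) (ip_stiefel sw); ring.
rewrite !E // ler_pM2l // lerB // ler_pM2l //.
have := Hy _ sz; rewrite -(@ler_sqr _ (frob _)) ?nnegrE ?frob_ge0 // => H.
rewrite !frob_sqrB !frob_sqr (ip_stiefel sy) (ip_stiefel sz) in H.
by rewrite !(ipC (mean x)); lra.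
Qed.

Lemma variance_mean x y :
  \sum_i frob (x i - mean x) ^+ 2 = \sum_i frob (x i - y) ^+ 2 - n%:R * frob (mean x - y) ^+ 2.
Proof.
set m := mean x.
have S : \sum_i (x i - y) = n%:R *: (m - y).
  rewrite sumrB sumr_const card_ord scalerBr -(scaler_nat n y) /m /mean scalerA divff //.
  by rewrite scale1r.
rewrite (eq_bigr (fun i => frob (x i - y) ^+ 2 - 2%:R * ip (x i - y) (m - y) + frob (m - y) ^+ 2)) => [|i _].
  rewrite big_split sumrB /= -mulr_sumr -ip_suml S sumr_const card_ord ipZl frob_sqr.
  by rewrite -[_ *+ n]mulr_natl; ring.
by rewrite -frob_sqrB opprB addrA subrK.
Qed.

(** By [mean_polar] each mean pairs with the displacement from the other base point by at least half
    of [(1 - e / 2) |y - y'|^2]. Adding the two bounds and applying Cauchy-Schwarz gives the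
    claim. *)
Lemma nearest_mean_lipschitz x x' y y' (e : R) :
  (forall i, stiefel (x i)) -> (forall i, stiefel (x' i)) -> stiefel y -> stiefel y' ->
  proj_tangent y (mean x) = 0 -> proj_tangent y' (mean x') = 0 ->
  \sum_i frob (x i - y) ^+ 2 <= n%:R * e -> \sum_i frob (x' i - y') ^+ 2 <= n%:R * e ->
  (1 - e / 2%:R) * frob (y - y') <= frob (mean x - mean x').
Proof.
move=> sx sx' sy sy' hy hy' He He'.
have half u v w : (forall i, stiefel (u i)) -> stiefel v -> stiefel w -> proj_tangent v (mean u) = 0 ->
    \sum_i frob (u i - v) ^+ 2 <= n%:R * e ->
    2%:R^-1 * (1 - e / 2%:R) * frob (v - w) ^+ 2 <= ip (v - w) (mean u).
  move=> su sv sw hv Hv; rewrite (mean_polar su sv hv) ipDr ipNr.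
  have := ip_stiefel_gram sv sw (dispersion_sym u v).
  have := ip_stiefel_gram sv sw (trmx1 _ _).
  rewrite mulmx1 => -> ->.
  have -> : ip (gram (v - w)) 1%:M = frob (v - w) ^+ 2.
    by rewrite /gram ip_mull trmxK mulmx1 frob_sqr.
  have h1 := ip_le (gram (v - w)) (dispersion u v).
  have h2 := frob_gram (v - w); have h3 := frob_dispersion u v.
  have h4 : (2%:R * n%:R)^-1 * \sum_i frob (u i - v) ^+ 2 <= e / 2%:R.
    apply: le_trans (ler_wpM2l _ Hv) _; first by rewrite invr_ge0 mulr_ge0 ?ler0n.
    by rewrite le_eqVlt; apply/orP; left; apply/eqP; field.
  have h5 : frob (gram (v - w)) * frob (dispersion u v) <= frob (v - w) ^+ 2 * (e / 2%:R).
    by apply: ler_pM => //; rewrite ?frob_ge0 //; lra.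
  lra.
have h1 := half x y y' sx sy sy' hy He.
have h2 := half x' y' y sx' sy' sy hy' He'.
have h3 := ip_le (y - y') (mean x - mean x').
have [/eqP e0|e0] := boolP (frob (y - y') == 0); first by rewrite e0 mulr0 frob_ge0.
have fp : 0 < frob (y - y') by rewrite lt_def e0 frob_ge0.
rewrite -(ler_pM2l fp) (le_trans _ h3) //.
rewrite frobBC in h2; move: h1 h2; rewrite !ip_expand; lra.
Qed.
End Mean.

(** * One step of the algorithm *)

Section Consensus.
Variables (R : realType) (n d r : nat).
Hypothesis n0 : (0 < n)%N.
Variable A : 'M[R]_n.
Hypothesis SA : sym_stochastic A.
Variables (x : 'I_n -> 'M[R]_(d, r)) (xb : 'M[R]_(d, r)).
Hypothesis sx : forall i, stiefel (x i).
Hypothesis sb : stiefel xb.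
Hypothesis nb : proj_tangent xb (mean x) = 0.

Let np : 0 < (n%:R : R). Proof. by rewrite ltr0n. Qed.
Let A0 i j : 0 <= A i j. Proof. by case: SA. Qed.
Let A1 i : \sum_j A i j = 1. Proof. by case: SA. Qed.
Let A1' j : \sum_i A i j = 1.
Proof. by case: SA => As _ _; rewrite -(A1 j); apply: eq_bigr => i _; rewrite -[in RHS]As mxE. Qed.

Definition mixed i : 'M[R]_(d, r) := \sum_j A i j *: x j.
Definition consensus_dir i := proj_tangent (x i) (mixed i).
Definition spread i : 'M[R]_r := \sum_j A i j *: gram (x i - x j).
Local Notation g := consensus_dir.
Local Notation e2 := (\sum_i frob (x i - xb) ^+ 2).

Lemma mixed_sub a i : mixed i - a = \sum_j A i j *: (x j - a).
Proof.
rewrite [RHS](eq_bigr (fun j => A i j *: x j - A i j *: a)) => [|j _]; last by rewrite scalerBr.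
by rewrite sumrB -scaler_suml A1 scale1r.
Qed.

Lemma spread_sym i : (spread i)^T = spread i.
Proof.
rewrite /spread raddf_sum; apply: eq_bigr => j _.
by rewrite [LHS]linearZ /= gram_sym.
Qed.

Lemma frob_spread i : frob (spread i) <= \sum_j A i j * frob (x i - x j) ^+ 2.
Proof.
apply: le_trans (frob_sum _ _ _) _; apply: ler_sum => j _.
by rewrite frobZ ger0_norm // ler_wpM2l // frob_gram.
Qed.

Lemma sum_frob_spread : \sum_i frob (spread i) <= 2%:R * energy A x.
Proof.
rewrite /energy mulrA divff ?pnatr_eq0 // mul1r.
by apply: ler_sum => i _; exact: frob_spread.
Qed.

(** The projection removes the normal part of [mixed i]; by [stiefel_gram] the correction to
    [mixed i - x i] is quadratic in the differences [x i - x j]. *)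
Lemma consensus_dirE i : g i = mixed i - x i + 2%:R^-1 *: (x i *m spread i).
Proof.
rewrite /consensus_dir /proj_tangent.
suff -> : spread i = 2%:R *: 1%:M - ((mixed i)^T *m x i + (x i)^T *m mixed i).
  rewrite mulmxBr -scalemxAr mulmx1 scalerBr scalerA mulVf ?pnatr_eq0 // scale1r.
  by rewrite addrA subrK.
rewrite /spread (eq_bigr (fun j => A i j *: (2%:R *: 1%:M) - A i j *: ((x j)^T *m x i + (x i)^T *m x j))) => [|j _].
  rewrite sumrB -scaler_suml A1 scale1r; congr (_ - _).
  rewrite /mixed [(\sum_j A i j *: x j)^T]raddf_sum /= mulmx_suml mulmx_sumr -big_split /=.
  apply: eq_bigr => j _; rewrite [(A i j *: x j)^T]linearZ /= -scalemxAl -scalemxAr scalerDr.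
  by [].
rewrite -scalerBr; congr (_ *: _); rewrite /gram stiefel_gram //; congr (_ - _).
by rewrite addrC.
Qed.

Lemma frob_consensus_dir i : frob (g i) <= frob (x i - mixed i).
Proof.
have -> : g i = proj_tangent (x i) (1 *: mixed i + (-1) *: x i).
  by rewrite proj_tangent_lin proj_tangent_base // scaler0 addr0 scale1r.
apply: le_trans (frob_proj_tangent _ (sx i)) _.
by rewrite scale1r scaleN1r frobBC.
Qed.

Lemma sum_frob_consensus_dir : \sum_i frob (g i) ^+ 2 <= \sum_i frob (x i - mixed i) ^+ 2.
Proof.
by apply: ler_sum => i _; rewrite ler_sqr ?nnegrE ?frob_ge0 // frob_consensus_dir.
Qed.

Lemma sum_consensus_dir_smooth : \sum_i frob (g i) ^+ 2 <= (1 - eign A) * energy A x.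
Proof. exact: le_trans sum_frob_consensus_dir (energy_smooth SA n0 x). Qed.

(** Eigenvalues of [A] are at least -1; here this comes from [|X + A X|^2 >= 0] together with
    [|A X| <= |X|]. *)
Lemma energy_le : energy A x <= 2%:R * e2.
Proof.
rewrite -(energy_translate A x xb) energy_stack //.
set X := stack _; have -> : e2 = ip X X.
  by rewrite -frob_sqr frob_stack.
have h := stochastic_form_le (A *m X) SA.
have h1 := stochastic_contract X SA.
have := ip_ge0 (X + A *m X); rewrite !ip_expand (ipC (A *m X) X); lra.
Qed.

Lemma sum_frob_consensus_dir_le : \sum_i frob (g i) ^+ 2 <= 4%:R * e2.
Proof.
apply: le_trans sum_frob_consensus_dir _.
rewrite (eq_bigr (fun i => frob ((x i - xb) - \sum_j A i j *: (x j - xb)) ^+ 2)) => [|i _]; last first.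
  by rewrite -mixed_sub opprB addrA subrK.
pose X := stack (fun i => x i - xb).
have -> : e2 = ip X X.
  by rewrite -frob_sqr frob_stack.
have -> : \sum_i frob (x i - xb - \sum_j A i j *: (x j - xb)) ^+ 2 = ip (X - A *m X) (X - A *m X).
  have -> : X - A *m X = stack (fun i => (x i - xb) - \sum_j A i j *: (x j - xb)).
    by rewrite mul_stack; apply/row_matrixP => i; rewrite [LHS]raddfB /= !row_stack [RHS]raddfB.
  by rewrite -frob_sqr frob_stack.
have h1 := stochastic_contract X SA.
have := ip_ge0 (X + A *m X); rewrite !ip_expand (ipC (A *m X) X); lra.
Qed.

(** The linear parts [mixed i - x i] cancel in the sum because columns of [A] sum to 1. Only the
    quadratic corrections survive, so consensus moves the mean to second order only. *)
Lemma frob_sum_consensus_dir : frob (\sum_i g i) <= energy A x.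
Proof.
have -> : \sum_i g i = 2%:R^-1 *: \sum_i (x i *m spread i).
  under eq_bigr => i _ do rewrite consensus_dirE.
  rewrite big_split /= scaler_sumr sumrB (_ : \sum_i mixed i = \sum_i x i) ?subrr ?add0r //.
  by rewrite /mixed exchange_big /=; apply: eq_bigr => j _; rewrite -scaler_suml A1' scale1r.
rewrite frobZ ger0_norm ?invr_ge0 //.
rewrite mulrC ler_pdivrMr // mulrC.
apply: le_trans sum_frob_spread; apply: le_trans (frob_sum _ _ _) _.
by apply: ler_sum => i _; rewrite frob_stiefel_mul.
Qed.

Section Rate.
Variables (delta1 delta2 nu alpha : R).
Hypothesis He2 : e2 <= n%:R * delta1 ^+ 2.
Hypothesis Hinf : forall i, frob (x i - xb) <= delta2.

(** The linear part of the direction contributes exactly the energy. The normal correction pairs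
    [gram (x i - xb)], of size at most [delta2 ^ 2], with [spread i], whose norms sum to at most
    twice the energy. *)
Lemma restricted_secant : (1 - delta2 ^+ 2 / 2%:R) * energy A x <= - \sum_i ip (x i - xb) (g i).
Proof.
have -> : - \sum_i ip (x i - xb) (g i) =
    energy A x - 4%:R^-1 * \sum_i ip (gram (x i - xb)) (spread i).
  rewrite -(energy_translate A x xb) -energy_ip // mulr_sumr -sumrB -sumrN.
  apply: eq_bigr => i _; rewrite consensus_dirE ipDr ipZr.
  rewrite (ip_stiefel_gram (sx i) sb (spread_sym i)) -mixed_sub.
  rewrite opprB (addrA (x i - xb)) subrK -[mixed i - x i]opprB ipNr.
  by field.
suff : \sum_i ip (gram (x i - xb)) (spread i) <= delta2 ^+ 2 * (2%:R * energy A x) by lra.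
apply: le_trans (ler_wpM2l (sqr_ge0 _) sum_frob_spread); rewrite mulr_sumr.
apply: ler_sum => i _; apply: le_trans (ip_le _ _) _.
apply: ler_wpM2r; first exact: frob_ge0.
apply: le_trans (frob_gram _) _; rewrite ler_sqr ?nnegrE ?frob_ge0 //.
exact: le_trans (frob_ge0 _) (Hinf i).
Qed.

(** The spectral gap concerns deviations from the Euclidean mean. Passing to [xb] costs
    [n |mean x - xb|^2], which is quartic in the deviations by [frob_mean]. *)
Lemma mean_variance_ge : (1 - delta1 ^+ 2 / 4%:R) * e2 <= \sum_i frob (x i - mean x) ^+ 2.
Proof.
rewrite (variance_mean n0 x xb).
have h := frob_mean n0 sx sb nb.
have e0 : 0 <= e2 by apply: sumr_ge0 => i _; exact: sqr_ge0.
have h2 : frob (mean x - xb) ^+ 2 <= ((2%:R * n%:R)^-1 * e2) ^+ 2.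
  by rewrite ler_sqr ?nnegrE ?frob_ge0 // mulr_ge0 // invr_ge0 mulr_ge0.
have h3 : n%:R * frob (mean x - xb) ^+ 2 <= e2 * (e2 / n%:R) / 4%:R.
  apply: le_trans (ler_wpM2l (ltW np) h2) _.
  by rewrite le_eqVlt; apply/orP; left; apply/eqP; field; rewrite gt_eqF.
have h4 : e2 * (e2 / n%:R) <= e2 * delta1 ^+ 2.
  by apply: ler_wpM2l => //; rewrite ler_pdivrMr // mulrC.
lra.
Qed.

Hypothesis Hnu : 0 < nu < 1.
Hypothesis a0 : 0 < alpha.
Hypothesis Ha : alpha * (1 - eign A) <= nu * (2%:R - delta2 ^+ 2).
Hypothesis d2 : delta2 ^+ 2 <= 1.
Hypothesis mu0 : 0 <= 1 - eig2 A.
Hypothesis r1 : (1 <= r)%N.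
Hypothesis d1 : 4%:R * r%:R * delta1 ^+ 2 <= 1.

Let e := frob (stack (fun i => x i - xb)).
Local Notation rho := (rho_t nu alpha (gamma_t r delta1 delta2 (1 - eig2 A))).

(** Expanding the square, the smoothness bound and the restriction on [alpha] absorb the [|g|^2]
    term into a share [nu] of the secant term. The remaining share [1 - nu] is bounded through the
    spectral gap and produces [gamma_t]. *)
Lemma consensus_contraction :
  frob (stack (fun i => x i - xb + alpha *: g i)) <= rho * e.
Proof.
have eE : e ^+ 2 = e2 by rewrite frob_stack.
have e0 : 0 <= e by exact: frob_ge0.
have E0 := energy_ge0 SA x.
apply: frob_leP; first by rewrite mulr_ge0 // sqrtr_ge0.
rewrite exprMn eE.
have -> : ip (stack (fun i => x i - xb + alpha *: g i)) (stack (fun i => x i - xb + alpha *: g i)) =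
    e2 + 2%:R * alpha * (\sum_i ip (x i - xb) (g i)) + alpha ^+ 2 * \sum_i frob (g i) ^+ 2.
  rewrite ip_stack !mulr_sumr -!big_split /=; apply: eq_bigr => i _.
  by rewrite -frob_sqr frob_sqrD ipZr frobZ exprMn real_normK ?num_real //; ring.
set S := \sum_i ip _ _; have hS := restricted_secant; rewrite -/S in hS.
have hg := sum_consensus_dir_smooth; have hv := mean_variance_ge.
have hgap := energy_gap SA n0 x; rewrite -/(mean x) in hgap.
set g2 := \sum_i frob (g i) ^+ 2 in hg *; set V := \sum_i frob (x i - mean x) ^+ 2 in hv hgap.
set E := energy A x in E0 hS hg hgap.
have /andP [nu0 nu1] := Hnu.
have e20 : 0 <= e2 by rewrite -eE sqr_ge0.
clearbody S g2 V E; move: (e2) e20 hv => q q0 hv.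
have h1 : alpha * g2 <= - (2%:R * nu * S).
  have h : alpha * g2 <= alpha * ((1 - eign A) * E) by rewrite ler_pM2l.
  have h' : alpha * (1 - eign A) * E <= nu * (2%:R - delta2 ^+ 2) * E by apply: ler_wpM2r.
  have := ler_wpM2l (ltW nu0) hS; rewrite mulrN => h''.
  apply: le_trans h _; rewrite mulrA; apply: le_trans h' _.
  rewrite (_ : nu * _ * E = 2%:R * (nu * ((1 - delta2 ^+ 2 / 2%:R) * E))); last by field.
  by rewrite (_ : - (2%:R * nu * S) = 2%:R * - (nu * S)); [rewrite ler_pM2l|ring].
have h2 : alpha * (alpha * g2) <= alpha * - (2%:R * nu * S) by rewrite ler_pM2l.
have rr : 1 <= r%:R :> R by rewrite ler1n.
have dd : 0 <= delta1 ^+ 2 by exact: sqr_ge0.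
have h3 : gamma_t r delta1 delta2 (1 - eig2 A) * q <= - S.
  rewrite /gamma_t.
  have h4 : (1 - 4%:R * r%:R * delta1 ^+ 2) * q <= V.
    apply: le_trans hv; apply: ler_wpM2r => //.
    by move: (r%:R : R) rr => c rr; have := ler_wpM2r dd rr; lra.
  have h5 := ler_wpM2l mu0 h4.
  have h6 : 0 <= 1 - delta2 ^+ 2 / 2%:R by have := d2; lra.
  have h7 := ler_wpM2l h6 (le_trans h5 hgap).
  apply: le_trans hS; apply: le_trans h7.
  by rewrite le_eqVlt; apply/orP; left; apply/eqP; ring.
have h8 : 0 <= 2%:R * alpha * (1 - nu) by rewrite !mulr_ge0 ?ltW // subr_gt0.
have h9 := ler_wpM2l h8 h3.
have h10 : (1 - 2%:R * (1 - nu) * alpha * gamma_t r delta1 delta2 (1 - eig2 A)) * q <= rho ^+ 2 * q.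
  apply: ler_wpM2r => //; rewrite /rho_t.
  (* A negative radicand is truncated to 0 by the square root, which keeps the inequality. *)
  set c := 1 - _; have [c0|c0] := leP 0 c; first by rewrite sqr_sqrtr.
  by apply: le_trans (sqr_ge0 _); exact: ltW.
apply: le_trans h10; move: h2 h9; move: (gamma_t _ _ _ _) => ga h2 h9.
rewrite expr2 -mulrA mulrBl mul1r.
suff : 2%:R * alpha * S + alpha * (alpha * g2) <= - (2%:R * alpha * (1 - nu) * (ga * q)).
  by rewrite (_ : 2%:R * (1 - nu) * alpha * ga * q = 2%:R * alpha * (1 - nu) * (ga * q)); [lra|ring].
apply: le_trans (_ : 2%:R * alpha * (1 - nu) * S <= _).
  apply: le_trans (lerD (lexx _) h2) _.
  by rewrite le_eqVlt; apply/orP; left; apply/eqP; ring.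
by rewrite lerNr -mulrN.
Qed.
End Rate.
End Consensus.

Lemma radius_bound (R : realType) (r : nat) (delta1 delta2 : R) : 0 < delta1 ->
  5%:R * Num.sqrt r%:R * delta1 <= delta2 -> delta2 <= 6%:R^-1 ->
  4%:R * r%:R * delta1 ^+ 2 <= 1.
Proof.
move=> d10 d12 d2.
have h : (5%:R * Num.sqrt r%:R * delta1) ^+ 2 <= 6%:R^-1 ^+ 2.
  rewrite ler_sqr ?nnegrE ?invr_ge0 //; first exact: le_trans d12 d2.
  by rewrite !mulr_ge0 ?sqrtr_ge0 // ltW.
rewrite !exprMn sqr_sqrtr ?ler0n // in h.
move: h; move: (r%:R : R) => c h.
lra.
Qed.

(** * Invariance of the neighbourhood and drift of the mean in one iteration *)

Section Step.
Variables (R : realType) (n d r : nat).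
Hypothesis n0 : (0 < n)%N.
Hypothesis r1 : (1 <= r)%N.
Variable M : R.
Hypothesis M0 : 0 < M.
Hypothesis HMr : forall x xi : 'M[R]_(d, r), stiefel x -> tangent x xi ->
  frob (polar_retr x xi - (x + xi)) <= M * frob xi ^+ 2.
Variable A : 'M[R]_n.
Hypothesis SA : sym_stochastic A.
Hypothesis mixA : forall i, \sum_j `|A i j - n%:R^-1| <= 2%:R^-1.
Variables delta1 delta2 nu alpha L beta : R.
Hypothesis d10 : 0 < delta1.
Hypothesis d12 : 5%:R * Num.sqrt r%:R * delta1 <= delta2.
Hypothesis d2 : delta2 <= 6%:R^-1.
Hypothesis Hnu : 0 < nu < 1.
Hypothesis a0 : 0 < alpha.
Hypothesis a1 : alpha <= 1.
Hypothesis aM : alpha * M <= 1.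
Hypothesis Ha : alpha * (1 - eign A) <= nu * (2%:R - delta2 ^+ 2).
Hypothesis mu0 : 0 <= 1 - eig2 A.
Hypothesis L0 : 0 < L.
Hypothesis b0 : 0 < beta.
Local Notation rho := (rho_t nu alpha (gamma_t r delta1 delta2 (1 - eig2 A))).
Hypothesis b1 : beta * L <= (1 - rho) * delta1.
Hypothesis b2 : 5%:R * (beta * L) <= alpha * delta1.

Variables (x : 'I_n -> 'M[R]_(d, r)) (xb : 'M[R]_(d, r)).
Hypothesis sx : forall i, stiefel (x i).
Hypothesis nx : nearest_stiefel (mean x) xb.
Hypothesis Hx : in_nbhd delta1 delta2 x xb.
Variable xi : 'I_n -> 'M[R]_(d, r).
Hypothesis txi : forall i, tangent (x i) (xi i).
Hypothesis bxi : forall i, frob (xi i) <= L.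
Local Notation g := (consensus_dir A x).
Variables (x' : 'I_n -> 'M[R]_(d, r)) (xb' : 'M[R]_(d, r)).
Hypothesis x'E : forall i, x' i = polar_retr (x i) (alpha *: g i - beta *: xi i).
Hypothesis nx' : nearest_stiefel (mean x') xb'.

Let np : 0 < (n%:R : R). Proof. by rewrite ltr0n. Qed.
Let sqrt_r : 1 <= Num.sqrt r%:R :> R.
Proof. by rewrite -[X in X <= _]sqrtr1 ler_sqrt ?ltr0n // ler1n. Qed.
Let d15 : 5%:R * delta1 <= delta2.
Proof.
apply: le_trans d12; rewrite -mulrA ler_pM2l // ler_peMl // ltW //.
Qed.
Let d1r : 4%:R * r%:R * delta1 ^+ 2 <= 1. Proof. exact: radius_bound d10 d12 d2. Qed.
Let sb : stiefel xb. Proof. by case: nx. Qed.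
Let sb' : stiefel xb'. Proof. by case: nx'. Qed.
Let nb : proj_tangent xb (mean x) = 0.
Proof. by apply: nearest_stiefel_normal nx => z tz; apply: HMr. Qed.
Let nb' : proj_tangent xb' (mean x') = 0.
Proof. by apply: nearest_stiefel_normal nx' => z tz; apply: HMr. Qed.
Let eta i := alpha *: g i - beta *: xi i.
Let teta i : tangent (x i) (eta i).
Proof.
rewrite /eta -scaleNr; apply: tangent_lin => //; exact: proj_tangent_tangent.
Qed.
Let e2 := \sum_i frob (x i - xb) ^+ 2.
Let He2 : e2 <= n%:R * delta1 ^+ 2. Proof. by case: Hx. Qed.
Let Hinf i : frob (x i - xb) <= delta2. Proof. by case: Hx. Qed.

Lemma step_stiefel i : stiefel (x' i).
Proof. by rewrite x'E; exact: polar_stiefel. Qed.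

Lemma step_to_base i : frob (x' i - xb) <= frob (x i - xb + alpha *: g i - beta *: xi i).
Proof.
rewrite x'E; apply: le_trans (polar_nonexpansive (sx i) (teta i) sb) _.
by rewrite /eta addrAC addrA.
Qed.

(** [xb'] minimises the sum of squared distances to the new points, so it may be replaced by the old
    [xb]. Nonexpansiveness then removes the retraction, and the remainder is the contracted error
    plus the subgradient forcing. *)
Lemma step_consensus :
  frob (stack (fun i => x' i - xb')) <= rho * frob (stack (fun i => x i - xb)) + beta * (Num.sqrt n%:R * L).
Proof.
have h1 : frob (stack (fun i => x' i - xb')) <= frob (stack (fun i => x i - xb + alpha *: g i - beta *: xi i)).
  rewrite -(@ler_sqr _ (frob _)) ?nnegrE ?frob_ge0 // !frob_stack.
  apply: le_trans (nearest_mean_le n0 step_stiefel nx' sb) _.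
  by apply: ler_sum => i _; rewrite ler_sqr ?nnegrE ?frob_ge0 // step_to_base.
apply: le_trans h1 _.
have -> : stack (fun i => x i - xb + alpha *: g i - beta *: xi i) =
    stack (fun i => x i - xb + alpha *: g i) - beta *: stack xi.
  apply/row_matrixP => i; rewrite [RHS]raddfB /= [X in _ - X]linearZ /= !row_stack.
  by rewrite [LHS]raddfB /= [mxvec (beta *: _)]linearZ.
apply: le_trans (frobB _ _) _; apply: lerD.
  have nu01 := Hnu.
  apply: consensus_contraction => //.
  have := d2; have := d15; have := d10 => h3 h4 h5.
  have h6 : 0 <= delta2 by lra.
  rewrite -(expr1n _ 2) ler_sqr ?nnegrE //; lra.
rewrite frobZ gtr0_norm //; apply: ler_wpM2l; first exact: ltW.
have sn := sqrtr_ge0 (n%:R : R).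
apply: frob_leP; first by rewrite mulr_ge0 // ltW.
rewrite -frob_sqr frob_stack exprMn sqr_sqrtr ?ler0n //.
apply: le_trans (_ : \sum_(i < n) L ^+ 2 <= _).
  by apply: ler_sum => i _; rewrite ler_sqr ?nnegrE ?frob_ge0 // ltW.
by rewrite sumr_const card_ord -[_ *+ n]mulr_natl.
Qed.

Lemma step_l2_invariant : \sum_i frob (x' i - xb') ^+ 2 <= n%:R * delta1 ^+ 2.
Proof.
rewrite -frob_stack.
have -> : n%:R * delta1 ^+ 2 = (Num.sqrt n%:R * delta1) ^+ 2 by rewrite exprMn sqr_sqrtr ?ler0n.
have sn := sqrtr_ge0 (n%:R : R).
have sd : 0 <= Num.sqrt n%:R * delta1 by rewrite mulr_ge0 // ltW.
rewrite ler_sqr ?nnegrE ?frob_ge0 //; apply: le_trans step_consensus _.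
have h : frob (stack (fun i => x i - xb)) <= Num.sqrt n%:R * delta1.
  by rewrite -(@ler_sqr _ (frob _)) ?nnegrE ?frob_ge0 // frob_stack exprMn sqr_sqrtr ?ler0n.
have h1 := ler_wpM2l (sqrtr_ge0 _ : 0 <= rho) h.
have h2 := ler_wpM2l sn b1.
move: (rho) h1 h2 => c h1 h2.
by apply: le_trans (lerD h1 (lexx _)) _; lra.
Qed.

Lemma sum_eta_sqr : \sum_i frob (eta i) ^+ 2 <= 8%:R * alpha ^+ 2 * e2 + 2%:R * n%:R * (beta * L) ^+ 2.
Proof.
have h : \sum_i frob (eta i) ^+ 2 <= \sum_i (2%:R * alpha ^+ 2 * frob (g i) ^+ 2 + 2%:R * (beta * L) ^+ 2).
  apply: ler_sum => i _; rewrite /eta.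
  have h1 := sqr_ge0 (frob (alpha *: g i + beta *: xi i)).
  have h2 : frob (beta *: xi i) ^+ 2 <= (beta * L) ^+ 2.
    rewrite ler_sqr ?nnegrE ?frob_ge0 ?(mulr_ge0 (ltW b0) (ltW L0)) // frobZ gtr0_norm //.
    by apply: ler_wpM2l => //; exact: ltW.
  have h3 : frob (alpha *: g i) ^+ 2 = alpha ^+ 2 * frob (g i) ^+ 2.
    by rewrite frobZ exprMn real_normK ?num_real.
  rewrite frob_sqrD in h1; rewrite frob_sqrB; lra.
apply: le_trans h _; rewrite big_split /= -mulr_sumr sumr_const card_ord.
have h := sum_frob_consensus_dir_le SA xb sx.
have a2 : 0 <= 2%:R * alpha ^+ 2 by rewrite mulr_ge0 // sqr_ge0.
have := ler_wpM2l a2 h; rewrite -/e2 -[_ *+ n]mulr_natl; move: (\sum_i _) (n%:R : R) => s c; lra.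
Qed.

(** Consensus moves the sum by at most [2 alpha e2], and the retraction errors add up to [M] times
    [sum_eta_sqr]. With [alpha * M <= 1] the coefficients 2 and 8 combine to 10. *)
Lemma step_mean_drift :
  frob (mean x' - mean x + n%:R^-1 *: \sum_i beta *: xi i) <=
  10%:R * alpha * (n%:R^-1 * e2) + 2%:R * M * (beta * L) ^+ 2.
Proof.
have -> : mean x' - mean x + n%:R^-1 *: \sum_i beta *: xi i =
    n%:R^-1 *: (\sum_i (x' i - (x i + eta i)) + alpha *: \sum_i g i).
  rewrite /mean -scalerBr -scalerDr; congr (_ *: _).
  rewrite scaler_sumr -sumrB -!big_split /=; apply: eq_bigr => i _.
  by rewrite /eta !opprD opprK -!addrA; congr (_ + (_ + _)); rewrite addrCA addNr addr0.
rewrite frobZ ger0_norm ?invr_ge0 ?ler0n //.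
have h1 : frob (\sum_i (x' i - (x i + eta i))) <= M * \sum_i frob (eta i) ^+ 2.
  apply: le_trans (frob_sum _ _ _) _; rewrite mulr_sumr; apply: ler_sum => i _.
  by rewrite x'E; apply: HMr.
have h2 : frob (alpha *: \sum_i g i) <= alpha * (2%:R * e2).
  rewrite frobZ gtr0_norm // ler_pM2l //.
  by apply: le_trans (frob_sum_consensus_dir SA sx) (energy_le SA x xb).
have h3 := ler_wpM2l (ltW M0) sum_eta_sqr.
have e20 : 0 <= e2 by apply: sumr_ge0 => i _; exact: sqr_ge0.
have h4 : alpha * M * (8%:R * alpha * e2) <= 1 * (8%:R * alpha * e2).
  by apply: ler_wpM2r => //; rewrite !mulr_ge0 // ltW.
have h5 := frobD (\sum_i (x' i - (x i + eta i))) (alpha *: \sum_i g i).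
have -> : 10%:R * alpha * (n%:R^-1 * e2) + 2%:R * M * (beta * L) ^+ 2 =
    n%:R^-1 * (10%:R * alpha * e2 + M * (2%:R * n%:R * (beta * L) ^+ 2)).
  by field; rewrite gt_eqF.
apply: ler_wpM2l; first by rewrite invr_ge0 ler0n.
move: h1 h2 h3 h5; move: (\sum_i frob (eta i) ^+ 2) (frob _) (frob _) (frob _) (n%:R : R) => s p q o c.
by move=> *; lra.
Qed.

(** The bound [5 beta L <= alpha delta1] yields [delta1 / 5] from the subgradient term and, with
    [alpha * M <= 1], [2 / 25 delta1 ^ 2] from the retraction error. *)
Lemma step_mean_drift_le : frob (mean x' - mean x) <= alpha * (10%:R * delta1 ^+ 2 + 2%:R / 25%:R * delta1 ^+ 2 + delta1 / 5%:R).
Proof.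
have h0 : frob (n%:R^-1 *: \sum_i beta *: xi i) <= beta * L.
  rewrite frobZ ger0_norm ?invr_ge0 ?ler0n // ler_pdivrMl //.
  apply: le_trans (frob_sum _ _ _) _; apply: le_trans (_ : \sum_(i < n) (beta * L) <= _).
    by apply: ler_sum => i _; rewrite frobZ gtr0_norm // ler_pM2l.
  by rewrite sumr_const card_ord -[_ *+ n]mulr_natl.
have h1 := frobB (mean x' - mean x + n%:R^-1 *: \sum_i beta *: xi i) (n%:R^-1 *: \sum_i beta *: xi i).
rewrite addrK in h1; have h2 := step_mean_drift.
have h3 : n%:R^-1 * e2 <= delta1 ^+ 2 by rewrite mulrC ler_pdivrMr // mulrC.
have h4 : 10%:R * alpha * (n%:R^-1 * e2) <= 10%:R * alpha * delta1 ^+ 2.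
  by apply: ler_wpM2l => //; rewrite mulr_ge0 // ltW.
have bL : 0 <= beta * L by rewrite mulr_ge0 ?ltW.
have h5 : (5%:R * (beta * L)) ^+ 2 <= (alpha * delta1) ^+ 2.
  by rewrite ler_sqr ?nnegrE ?mulr_ge0 // ?ltW.
have h6 := ler_wpM2l (ltW M0) h5.
have h7 : alpha * M * (alpha * delta1 ^+ 2) <= 1 * (alpha * delta1 ^+ 2).
  by apply: ler_wpM2r => //; rewrite mulr_ge0 ?sqr_ge0 // ltW.
have h8 := b2; have h9 := le_trans h1 (lerD h2 h0).
apply: le_trans h9 _; move: (n%:R^-1 * e2) h4 => q h4; lra.
Qed.

(** The point before the subgradient step is the combination, with weights [1 - alpha] and [alpha],
    of the old deviation and a mixed one. By [mixA] mixing halves the uniform deviation, up to the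
    offset of the mean and the normal correction. *)
Lemma step_inf_base i : frob (x' i - xb) <=
  delta2 - alpha * (delta2 / 2%:R - delta1 ^+ 2 / 2%:R - 2%:R * delta2 ^+ 2 - delta1 / 5%:R).
Proof.
apply: le_trans (step_to_base i) _.
have -> : x i - xb + alpha *: g i = (1 - alpha) *: (x i - xb) +
    alpha *: ((\sum_j (A i j - n%:R^-1) *: (x j - xb)) + (mean x - xb) + 2%:R^-1 *: (x i *m spread A x i)).
  rewrite (consensus_dirE SA sx).
  have -> : \sum_j (A i j - n%:R^-1) *: (x j - xb) = (mixed A x i - xb) - (mean x - xb).
    rewrite (mixed_sub SA) /mean.
    rewrite (eq_bigr (fun j => A i j *: (x j - xb) - n%:R^-1 *: (x j - xb))) => [|j _]; last by rewrite scalerBl.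
    rewrite sumrB -scaler_sumr; congr (_ - _); rewrite sumrB scalerBr sumr_const card_ord; congr (_ - _).
    by rewrite -(scaler_nat n xb) scalerA mulVf ?scale1r // gt_eqF.
  move: (mixed A x i) (mean x) (2%:R^-1 *: _) => w m s.
  rewrite subrK scalerBl scale1r -[RHS]addrA [- _ + _]addrC -scalerBr.
  by congr (_ + _ *: _); rewrite [RHS]addrAC opprB addrA subrK.
have al0 : 0 <= 1 - alpha by have := a1; lra.
have f1 : frob ((1 - alpha) *: (x i - xb)) <= (1 - alpha) * delta2.
  by rewrite frobZ ger0_norm // ler_wpM2l.
have f2 : frob (\sum_j (A i j - n%:R^-1) *: (x j - xb)) <= 2%:R^-1 * delta2.
  apply: le_trans (frob_sum _ _ _) _.
  apply: le_trans (_ : \sum_j `|A i j - n%:R^-1| * delta2 <= _).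
    by apply: ler_sum => j _; rewrite frobZ ler_wpM2l.
  by rewrite -mulr_suml; apply: ler_wpM2r => //; exact: le_trans (frob_ge0 _) (Hinf i).
have f3 : frob (mean x - xb) <= delta1 ^+ 2 / 2%:R.
  apply: le_trans (frob_mean n0 sx sb nb) _.
  rewrite invfM -mulrA mulrC ler_pM2r ?invr_gt0 //.
  by rewrite mulrC ler_pdivrMr // mulrC.
have f4 : frob (2%:R^-1 *: (x i *m spread A x i)) <= 2%:R * delta2 ^+ 2.
  rewrite frobZ ger0_norm ?invr_ge0 // frob_stiefel_mul //.
  rewrite mulrC ler_pdivrMr //; apply: le_trans (frob_spread SA x i) _.
  have [_ A0 A1] := SA.
  apply: le_trans (_ : \sum_j A i j * (2%:R * delta2) ^+ 2 <= _).
    apply: ler_sum => j _; apply: ler_wpM2l => //.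
    have t : frob (x i - x j) <= 2%:R * delta2.
      apply: le_trans (frob_triangle xb _ _) _; rewrite (frobBC xb).
      have := Hinf i; have := Hinf j; lra.
    by rewrite ler_sqr ?nnegrE ?frob_ge0 // (le_trans (frob_ge0 _) t).
  by rewrite -mulr_suml A1; lra.
have f5 : frob (beta *: xi i) <= beta * L by rewrite frobZ gtr0_norm // ler_pM2l.
apply: le_trans (frobB _ _) _.
have f6 : forall u v : 'M[R]_(d, r), frob (u + alpha *: v) <= frob u + alpha * frob v.
  by move=> u v; apply: le_trans (frobD _ _) _; rewrite frobZ gtr0_norm.
have g1 := le_trans (f6 _ _) (lerD f1 (lexx _)).
apply: le_trans (lerD (g1 _) f5) _.
have g2 := le_trans (frobD _ _) (lerD (le_trans (frobD _ _) (lerD f2 f3)) f4).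
have g3 : alpha * frob (\sum_j (A i j - n%:R^-1) *: (x j - xb) + (mean x - xb) +
   2%:R^-1 *: (x i *m spread A x i)) <= alpha * (2%:R^-1 * delta2 + delta1 ^+ 2 / 2%:R + 2%:R * delta2 ^+ 2).
  by rewrite ler_pM2l.
have h8 := b2; lra.
Qed.

(** The gain in [step_inf_base] must cover the motion of the base point. From
    [5 delta1 <= delta2 <= 1/6] the gain is at least [0.61 alpha delta1], while
    [(1 - 1/1800) |xb - xb'|] is at most [0.6 alpha delta1]. *)
Lemma step_inf_invariant i : frob (x' i - xb') <= delta2.
Proof.
apply: le_trans (frob_triangle xb _ _) _.
have h1 := step_inf_base i.
have h2 := nearest_mean_lipschitz n0 sx step_stiefel sb sb' nb nb' He2 step_l2_invariant.
have h3 := step_mean_drift_le; rewrite frobBC in h3.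
have D := d15; have D2 := d2; have D1 := d10.
have d130 : delta1 <= 30%:R^-1 by lra.
have dsq : delta1 ^+ 2 <= delta1 / 30%:R by rewrite expr2 ler_pM2l.
have dsq2 : delta2 ^+ 2 <= delta2 / 6%:R by rewrite expr2 ler_pM2l //; lra.
have f0 := frob_ge0 (xb - xb').
have h4 : (1 - 1800%:R^-1) * frob (xb - xb') <= alpha * (3%:R / 5%:R * delta1).
  apply: le_trans (_ : (1 - delta1 ^+ 2 / 2%:R) * frob (xb - xb') <= _).
    by apply: ler_wpM2r => //; lra.
  by apply: le_trans h2 _; apply: le_trans h3 _; rewrite ler_pM2l //; lra.
have h5 : alpha * (61%:R / 100%:R * delta1) <= alpha * (delta2 / 2%:R - delta1 ^+ 2 / 2%:R - 2%:R * delta2 ^+ 2 - delta1 / 5%:R).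
  by rewrite ler_pM2l //; lra.
have aD : 0 < alpha * delta1 by rewrite mulr_gt0.
lra.
Qed.

Lemma step_nbhd : in_nbhd delta1 delta2 x' xb'.
Proof. by split; [exact: step_l2_invariant|exact: step_inf_invariant]. Qed.
End Step.

(** * Real sequences *)

Section Sequences.
Variable R : realType.
Implicit Types (beta e v D : nat -> R).

Lemma nneseries_bounded (u : nat -> R) : (forall k, 0 <= u k) ->
  (\sum_(0 <= k <oo) (u k)%:E < +oo)%E -> exists B : R, forall N, \sum_(0 <= k < N) u k <= B.
Proof.
move=> u0 fin; have ge0 : (0 <= \sum_(0 <= k <oo) (u k)%:E)%E.
  by apply: nneseries_ge0 => k _ _; rewrite lee_fin.
exists (fine (\sum_(0 <= k <oo) (u k)%:E)) => N.
rewrite -lee_fin fineK ?ge0_fin_numE // -sumEFin.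
by apply: nneseries_lim_ge => k _ _; rewrite lee_fin.
Qed.

Lemma nneseries_unbounded (u : nat -> R) : (forall k, 0 <= u k) ->
  (\sum_(0 <= k <oo) (u k)%:E = +oo)%E -> forall B : R, exists N, B < \sum_(0 <= k < N) u k.
Proof.
move=> u0 inf B; apply: contrapT => /forallNP H.
have : (\sum_(0 <= k <oo) (u k)%:E <= B%:E)%E.
  apply: lime_le; first by apply: is_cvg_nneseries => k _ _; rewrite lee_fin.
  by apply: nearW => N; rewrite sumEFin lee_fin leNgt; apply/negP; exact: H.
by rewrite inf leye_eq.
Qed.

(* Since [beta] varies slowly, the geometric factor [rho < 1] turns a forcing of size [beta] into an error of size [beta]. *)
Lemma geometric_forcing (rho b : R) beta e : 0 <= rho < 1 -> 0 <= b ->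
  (forall k, 0 < beta k) -> (fun k => beta k.+1 / beta k) @ \oo --> (1 : R) ->
  (forall k, e k.+1 <= rho * e k + b * beta k) ->
  exists C K, 0 <= C /\ forall k, (K <= k)%N -> e k <= C * beta k.
Proof.
(* [q] lies halfway between [rho] and 1, so eventually [beta k.+1 > q * beta k] while a margin
   [q - rho] is left for the forcing. *)
move=> /andP[r0 r1] b0 bp br He; pose q := (1 + rho) / 2%:R.
have q1 : q < 1 by rewrite /q; lra.
have [K _ HK] := cvgr_gt _ br _ q1.
have rq : 0 < q - rho by rewrite /q; lra.
have x0 : 0 <= b / (q - rho) by apply: divr_ge0 => //; exact: ltW.
(* The first summand ensures [rho C + b <= q C]; the second covers the starting index [K]. *)
pose C := b / (q - rho) + `|e K| / beta K.
have CC : b <= C * (q - rho).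
  rewrite /C mulrDl divfK ?gt_eqF // lerDl.
  by apply: mulr_ge0; [apply: divr_ge0 => //; exact: ltW|exact: ltW].
have C0 : 0 <= C by apply: addr_ge0 => //; apply: divr_ge0 => //; exact: ltW.
exists C, K; split=> // k; elim: k => [|k IH].
  rewrite leqn0 => /eqP K0; rewrite /C K0 mulrDl divfK ?gt_eqF //.
  apply: le_trans (ler_norm _) _; rewrite lerDr (mulr_ge0 x0 (ltW (bp _))) //.
rewrite leq_eqVlt => /orP[/eqP <-|].
  rewrite /C mulrDl divfK ?gt_eqF //.
  apply: le_trans (ler_norm _) _; rewrite lerDr (mulr_ge0 x0 (ltW (bp _))) //.
rewrite ltnS => Kk; apply: le_trans (He k) _.
have := HK k Kk; rewrite /= ltr_pdivlMr // => h1.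
have h2 := ler_wpM2l r0 (IH Kk).
have h3 := ler_wpM2r (ltW (bp k)) CC.
have h4 := ler_wpM2l C0 (ltW h1).
lra.
Qed.

Section Descent.
Variables (beta v D : nat -> R) (c C l B : R) (K : nat).
Hypothesis c0 : 0 < c.
Hypothesis C0 : 0 <= C.
Hypothesis D0 : forall k, 0 <= D k.
Hypothesis bp : forall k, 0 < beta k.
Hypothesis lv : forall k, l <= v k.
Hypothesis HB : forall N, \sum_(0 <= k < N) beta k ^+ 2 <= B.
Hypothesis H : forall k, (K <= k)%N -> v k.+1 <= v k - c * (beta k * D k) + C * beta k ^+ 2.

(** Subtracting [C] times the convergent partial sums of [beta ^ 2] makes the sequence nonincreasing
    from [K] on and bounded below. *)
Lemma descent_cvg : exists lim : R, v @ \oo --> lim.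
Proof.
pose s N := \sum_(0 <= k < N) beta k ^+ 2.
have sS N : s N.+1 = s N + beta N ^+ 2 by rewrite /s big_nat_recr.
have sc : cvgn s.
  apply: nondecreasing_is_cvgn; last by exists B => _ [N _ <-]; exact: HB.
  by apply/nondecreasing_seqP => N; rewrite sS lerDl sqr_ge0.
pose u k := v (k + K)%N - C * s (k + K)%N.
have uc : cvgn u.
  apply: nonincreasing_is_cvgn.
    apply/nonincreasing_seqP => k; rewrite /u addSn sS.
    have h := H (leq_addl k K).
    have h1 : 0 <= c * (beta (k + K)%N * D (k + K)%N).
      by rewrite !mulr_ge0 // ltW.
    lra.
  exists (l - C * B) => _ [k _ <-]; rewrite /u lerB //.
  by apply: ler_wpM2l => //; exact: HB.
have sc' : (fun k => s (k + K)%N) @ \oo --> limn s by rewrite cvg_shiftn.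
have vc : (fun k => v (k + K)%N) @ \oo --> limn u + C * limn s.
  rewrite (_ : (fun k => v (k + K)%N) = (fun k => u k + C * s (k + K)%N)).
    by apply: cvgD => //; apply: cvgM => //; exact: cvg_cst.
  by apply/funext => k; rewrite /u subrK.
by exists (limn u + C * limn s); rewrite cvg_shiftn in vc.
Qed.

(** If the infimum [m] were positive, telescoping would bound [c m] times the partial sums of
    [beta], which are unbounded. *)
Lemma descent_inf0 : (forall T : R, exists N, T < \sum_(0 <= k < N) beta k) ->
  inf (range D) = 0.
Proof.
move=> Hu; have lbD : has_lbound (range D) by exists 0 => _ [k _ <-].
have i0 : 0 <= inf (range D) by apply: lb_le_inf; [exists (D 0%N), 0%N|move=> _ [k _ <-]].
apply/eqP; rewrite eq_le i0 andbT leNgt; apply/negP => ip0.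
set m := inf (range D) in i0 ip0.
have mD k : m <= D k by apply: ge_inf => //; exists k.
pose s N := \sum_(0 <= k < N) beta k ^+ 2; pose t N := \sum_(0 <= k < N) beta k.
have sS N : s N.+1 = s N + beta N ^+ 2 by rewrite /s big_nat_recr.
have tS N : t N.+1 = t N + beta N by rewrite /t big_nat_recr.
have key N : v (N + K)%N + c * m * (t (N + K)%N - t K) <= v K + C * (s (N + K)%N - s K).
  elim: N => [|N IH]; first by rewrite add0n !subrr !mulr0.
  rewrite addSn sS tS; have h := H (leq_addl N K).
  have h1 : c * (beta (N + K)%N * m) <= c * (beta (N + K)%N * D (N + K)%N).
    by rewrite !ler_pM2l.
  lra.
have cm : 0 < c * m by rewrite mulr_gt0.
have [N] := Hu (`|v K - l + C * B| / (c * m) + t K); apply/negP; rewrite -leNgt -/(t N).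
apply: le_trans (_ : t (N + K)%N <= _).
  elim: (K) => [|k IH]; first by rewrite addn0.
  by rewrite addnS tS; apply: le_trans IH _; rewrite lerDl ltW.
rewrite -lerBlDr ler_pdivlMr // mulrC; apply: le_trans (ler_norm _).
have := key N; have := lv (N + K)%N; have := ler_wpM2l C0 (HB (N + K)%N).
have s0 : 0 <= s K by apply: sumr_ge0 => k _; exact: sqr_ge0.
have := mulr_ge0 C0 s0; rewrite -/(s (N + K)%N); move=> *; lra.
Qed.
End Descent.
End Sequences.

(** * Moreau envelope on the Stiefel manifold *)

Section Envelope.
Variables (R : realType) (d r : nat).
Variables (F : 'M[R]_(d, r) -> R) (lam : R) (P : 'M[R]_(d, r) -> 'M[R]_(d, r)).
Hypothesis lam0 : 0 < lam.
Hypothesis HP : forall z, stiefel z -> is_prox F lam z (P z).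
Implicit Types x y z : 'M[R]_(d, r).
Local Notation fl := (moreau F lam).

Lemma moreau_prox x : stiefel x -> fl x = F (P x) + (2%:R * lam)^-1 * frob (P x - x) ^+ 2.
Proof.
move=> sx; have [sP Pmin] := HP sx; apply/eqP; rewrite eq_le; apply/andP; split.
  by apply: ge_inf; [exists (F (P x) + (2%:R * lam)^-1 * frob (P x - x) ^+ 2) => _ [y sy <-]; exact: Pmin|exists (P x)].
by apply: lb_le_inf => [|_ [y sy <-]]; [eexists; exists (P x)|exact: Pmin].
Qed.

Lemma moreau_le x y : stiefel x -> stiefel y -> fl x <= F y + (2%:R * lam)^-1 * frob (y - x) ^+ 2.
Proof. by move=> sx sy; rewrite moreau_prox //; have [_] := HP sx; apply. Qed.

(* On the Stiefel manifold the squared distance is affine in each argument. *)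
Lemma moreau_shift x x' : stiefel x -> stiefel x' ->
  fl x' <= fl x + lam^-1 * ip (P x) (x - x').
Proof.
move=> sx sx'; have [sP _] := HP sx.
apply: le_trans (moreau_le sx' sP) _; rewrite moreau_prox // -addrA lerD2l.
rewrite !frob_sqrB !frob_sqr !(ip_stiefel sx, ip_stiefel sx') ipDr ipNr le_eqVlt.
by apply/orP; left; apply/eqP; field; rewrite gt_eqF.
Qed.

(** Apply [moreau_shift] in both directions; proximal points lie on the manifold and so have norm
    [sqrt r]. *)
Lemma moreau_lipschitz x x' : stiefel x -> stiefel x' ->
  `|fl x - fl x'| <= Num.sqrt r%:R / lam * frob (x - x').
Proof.
have half y z : stiefel y -> stiefel z -> fl z - fl y <= Num.sqrt r%:R / lam * frob (y - z).
  move=> sy sz; have [sP _] := HP sy.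
  rewrite lerBlDl; apply: le_trans (moreau_shift sy sz) _; rewrite lerD2l.
  rewrite mulrAC mulrC ler_pM2r ?invr_gt0 // -(frob_stiefel sP); exact: ip_le.
move=> sx sx'; rewrite ler_norml; apply/andP; split.
  by rewrite lerNl opprB half.
by rewrite frobBC half.
Qed.
End Envelope.

(** * Decrease of the Moreau envelope in one iteration *)

Section Descent.
Variables (R : realType) (n d r : nat).
Hypothesis n0 : (0 < n)%N.
Variables (f : 'I_n -> 'M[R]_(d, r) -> R) (rho L lam : R) (P : 'M[R]_(d, r) -> 'M[R]_(d, r)).
Hypothesis lam0 : 0 < lam.
Hypothesis L0 : 0 < L.
Hypothesis rho0 : 0 <= rho.
Hypothesis HP : forall z, stiefel z -> is_prox (favg f) lam z (P z).
Hypothesis Hlip : forall i x y, stiefel x -> stiefel y -> `|f i x - f i y| <= L * frob (x - y).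
Implicit Types x y z : 'M[R]_(d, r).
Local Notation fl := (moreau (favg f) lam).

Lemma favg_lower z0 : stiefel z0 -> exists c : R, forall y, stiefel y -> c <= favg f y.
Proof.
move=> s0; exists (favg f z0 - L * (2%:R * Num.sqrt r%:R)) => y sy.
have h i : f i z0 - L * (2%:R * Num.sqrt r%:R) <= f i y.
  have := Hlip i s0 sy; rewrite ler_norml => /andP[_ h].
  have h1 : frob (z0 - y) <= 2%:R * Num.sqrt r%:R.
    by apply: le_trans (frobB _ _) _; rewrite !frob_stiefel //; lra.
  have h2 : L * frob (z0 - y) <= L * (2%:R * Num.sqrt r%:R) by rewrite ler_pM2l.
  by move: (L * (_ * _)) h2 => c h2; lra.
rewrite /favg; apply: le_trans (_ : n%:R^-1 * \sum_i (f i z0 - L * (2%:R * Num.sqrt r%:R)) <= _); last first.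
  by rewrite ler_pM2l ?invr_gt0 ?ltr0n //; apply: ler_sum.
rewrite sumrB sumr_const card_ord -[(L * _) *+ n]mulr_natl mulrBr mulKf //.
by rewrite pnatr_eq0 -lt0n.
Qed.

Lemma moreau_lower z0 : stiefel z0 -> exists c : R, forall y, stiefel y -> c <= fl y.
Proof.
move=> /favg_lower [c Hc]; exists c => y sy; have [sP _] := HP sy.
rewrite (moreau_prox HP sy); apply: le_trans (Hc _ sP) _.
by rewrite lerDl mulr_ge0 ?sqr_ge0 // invr_ge0 mulr_ge0 // ltW.
Qed.

Section OneStep.
Variables (x xi : 'I_n -> 'M[R]_(d, r)) (xb xb' m' : 'M[R]_(d, r)) (beta E e1 e2 e3 : R).
Hypothesis sx : forall i, stiefel (x i).
Hypothesis sb : stiefel xb.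
Hypothesis sb' : stiefel xb'.
Hypothesis b0 : 0 < beta.
Hypothesis HE : forall i, frob (x i - xb) <= E.
Hypothesis txi : forall i, tangent (x i) (xi i).
Hypothesis Hlow : forall i y, stiefel y ->
  f i (x i) + ip (xi i) (y - x i) - (rho + L) / 2%:R * frob (y - x i) ^+ 2 <= f i y.
Hypothesis H1 : frob (mean x - xb) <= e1.
Hypothesis H2 : frob (m' - xb') <= e2.
Hypothesis H3 : frob (m' - mean x + n%:R^-1 *: \sum_i beta *: xi i) <= e3.

(** A tangent [xi i] is orthogonal to [x i], so the subgradient inequality bounds [ip p (xi i)]
    itself. Replacing [x i] by [xb] in the value and in the squared distance costs terms linear in
    [E]. *)
Lemma ip_subgradient_le i p : stiefel p ->
  ip p (xi i) <= f i p - f i xb + (rho + L) / 2%:R * frob (xb - p) ^+ 2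
     + (L + (rho + L) * Num.sqrt r%:R) * E.
Proof.
move=> sp; have h := Hlow i sp.
have h1 : ip (xi i) (p - x i) = ip p (xi i).
  have := ip_tangent_normal (txi i) (trmx1 R r); rewrite mulmx1 => e.
  by rewrite ipDr ipNr e subr0 ipC.
have h2 : f i xb - f i (x i) <= L * E.
  have := Hlip i sb (sx i); rewrite ler_norml frobBC => /andP[_ h2].
  by apply: le_trans h2 _; rewrite ler_pM2l.
have h3 : frob (p - x i) ^+ 2 <= frob (xb - p) ^+ 2 + 2%:R * (Num.sqrt r%:R * E).
  have h4 := ip_le p (xb - x i); rewrite (frob_stiefel sp) ipDr ipNr frobBC in h4.
  have h5 := ler_wpM2l (sqrtr_ge0 (r%:R : R)) (HE i).
  rewrite !frob_sqrB !frob_sqr (ip_stiefel sb) (ip_stiefel sp) (ip_stiefel (sx i)) (ipC xb p).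
  by move: (frob _) (Num.sqrt r%:R : R) (r%:R : R) h4 h5 => a b c h4 h5; lra.
have c0 : 0 <= (rho + L) / 2%:R by rewrite divr_ge0 // addr_ge0 // ltW.
have h6 := ler_wpM2l c0 h3.
by rewrite h1 in h; move: (Num.sqrt _) h6 => s h6; lra.
Qed.

(** [moreau_shift] is linear in [xb - xb'], which splits into [beta] times the averaged subgradient
    and errors bounded by [e1], [e2], [e3]. On the former, optimality of [P xb] tested at [xb]
    converts the difference of function values into a negative squared distance. *)
Lemma envelope_descent :
  fl xb' <= fl xb - beta * (((2%:R * lam)^-1 - (rho + L) / 2%:R) / lam) * frob (xb - P xb) ^+ 2
    + lam^-1 * (beta * ((L + (rho + L) * Num.sqrt r%:R) * E) + Num.sqrt r%:R * (e1 + e2 + e3)).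
Proof.
have [sP Pmin] := HP sb; set p := P xb in sP Pmin *.
apply: le_trans (moreau_shift lam0 HP sb sb') _; rewrite -/p -addrA lerD2l.
rewrite (_ : - (beta * _ * _) + _ = lam^-1 * (beta * (- ((2%:R * lam)^-1 - (rho + L) / 2%:R) * frob (xb - p) ^+ 2 + (L + (rho + L) * Num.sqrt r%:R) * E) + Num.sqrt r%:R * (e1 + e2 + e3))); last first.
  by field; rewrite gt_eqF.
rewrite ler_pM2l ?invr_gt0 //.
have -> : xb - xb' = (n%:R^-1 *: \sum_i beta *: xi i) +
    ((m' - xb') - (mean x - xb) - (m' - mean x + n%:R^-1 *: \sum_i beta *: xi i)).
  move: (_ *: \sum_i _) (mean x) => s m; apply/matrixP => i j; rewrite !mxE; ring.
rewrite ipDr; apply: lerD; last first.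
  apply: le_trans (ip_le _ _) _; rewrite (frob_stiefel sP); apply: ler_wpM2l; first exact: sqrtr_ge0.
  apply: le_trans (frobB _ _) _; apply: lerD H3.
  by apply: le_trans (frobB _ _) _; rewrite addrC; apply: lerD.
rewrite -scaler_sumr !ipZr ip_sumr mulrCA ler_pM2l //.
have h : n%:R^-1 * \sum_i ip p (xi i) <= favg f p - favg f xb + (rho + L) / 2%:R * frob (xb - p) ^+ 2
     + (L + (rho + L) * Num.sqrt r%:R) * E.
  rewrite ler_pdivrMl ?ltr0n //.
  apply: le_trans (ler_sum _ (fun i _ => ip_subgradient_le i sP)) _.
  rewrite !big_split /= sumrN !sumr_const card_ord /favg.
  rewrite -[X in _ + X + _]mulr_natl -[X in _ + X]mulr_natl le_eqVlt.
  by apply/orP; left; apply/eqP; field; rewrite pnatr_eq0 -lt0n.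
apply: le_trans h _.
have := Pmin _ sb; rewrite subrr frob0 expr0n /= mulr0 addr0 frobBC.
by move: (favg f p) (favg f xb) (_^-1) => a b c; lra.
Qed.
End OneStep.
End Descent.

(** * Convergence *)

Unset Implicit Arguments. Set Strict Implicit. Set Printing Implicit Defensive.
Theorem theorem4p3 (R : realType) (n d r : nat)
  (Hn : (0 < n)%N) (Hr : (1 <= r)%N) (Hrd : (r <= d)%N)
  (* the local functions f_i, rho-weakly convex *)
  (f : 'I_n -> 'M[R]_(d, r) -> R) (rho : R) (Hrho : 0 <= rho)
  (Hwc : forall i, weakly_convex rho (f i))
  (* the constant L *)
  (L : R) (HL : 0 < L)
  (HU : exists U : set 'M[R]_(d, r),
      [/\ frob_open U, convex_set_mx U, frob_bounded U, stiefel `<=` U &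
          forall i (x y : 'M[R]_(d, r)), U x -> U y -> `|f i x - f i y| <= L * frob (x - y)])
  (Hlow : forall i (x y xi : 'M[R]_(d, r)), stiefel x -> stiefel y -> riem_subdiff rho (f i) x xi ->
      f i x + frob_inner xi (y - x) - (rho + L) / 2%:R * frob (y - x) ^+ 2 <= f i y)
  (HLb : forall i (x xi : 'M[R]_(d, r)), stiefel x -> riem_subdiff rho (f i) x xi -> frob xi <= L)
  (* the network and mixing matrix *)
  (G : rel 'I_n) (HGsym : symmetric G) (HGconn : forall i j, connect G i j)
  (W : 'M[R]_n) (HWsym : W^T = W) (HWnn : forall i j, 0 <= W i j)
  (HWrow : forall i, \sum_(j < n) W i j = 1)
  (HWsupp : forall i j, (W i j == 0) = ~~ ((j == i) || G i j))
  (* the retraction constant M *)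
  (M : R) (HM : 0 < M)
  (HMr : forall x xi : 'M[R]_(d, r), stiefel x -> tangent x xi ->
      frob (polar_retr x xi - (x + xi)) <= M * frob xi ^+ 2)
  (* constants delta1, delta2, nu *)
  (delta1 delta2 nu : R) (Hd2 : delta2 <= 6%:R^-1)
  (Hd1 : delta1 <= delta2 / (5%:R * Num.sqrt r%:R))
  (Hnu0 : 0 < nu) (Hnu1 : nu < 1)
  (* algorithm parameters *)
  (alpha : R) (t : nat) (beta : nat -> R)
  (Ht1 : (1 <= t)%N)
  (Htlog : (Num.ceil (logb (sing2 W) (2%:R * Num.sqrt n%:R)^-1) <= t%:Z)%R)
  (Halpha0 : 0 < alpha)
  (Halpha1 : alpha <= alphabar (1 - eign (mxpow W t)) nu (2%:R - delta2 ^+ 2) M)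
  (Hbeta : forall k, 0 < beta k /\
      beta k <= Num.min
        ((1 - rho_t nu alpha (gamma_t r delta1 delta2 (1 - eig2 (mxpow W t)))) * delta1 / L)
        (alpha * delta1 / (5%:R * L)))
  (Hbmono : forall k, beta k.+1 <= beta k)
  (Hbsum : (\sum_(0 <= k <oo) (beta k)%:E = +oo)%E)
  (Hblim : beta @ \oo --> (0 : R))
  (Hbratio : (fun k => beta k.+1 / beta k) @ \oo --> (1 : R))
  (* the DRSM iterates and the projected averages *)
  (x : nat -> 'I_n -> 'M[R]_(d, r)) (xbar : nat -> 'M[R]_(d, r))
  (Hx0 : forall i, stiefel (x 0%N i))
  (Hiter : forall k i, exists2 xi, riem_subdiff rho (f i) (x k i) xi &
      x k.+1 i = polar_retr (x k i)
        (alpha *: proj_tangent (x k i) (\sum_(j < n) mxpow W t i j *: x k j)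
         - beta k *: xi))
  (Hxbar : forall k, nearest_stiefel (n%:R^-1 *: \sum_(i < n) x k i) (xbar k))
  (HN0 : in_nbhd delta1 delta2 (x 0%N) (xbar 0%N))
  (* Moreau parameter and proximal mapping *)
  (lam : R) (Hlam0 : 0 < lam)
  (Hlam1 : lam < Num.min (rho + 3%:R * L)^-1 (2%:R * (rho + L))^-1)
  (P : 'M[R]_(d, r) -> 'M[R]_(d, r))
  (HP : forall z, stiefel z -> is_prox (favg f) lam z (P z)) :
  let rhot := rho_t nu alpha (gamma_t r delta1 delta2 (1 - eig2 (mxpow W t))) in
  let fl := moreau (favg f) lam in
  ((\sum_(0 <= k <oo) (beta k ^+ 2)%:E < +oo)%E ->
     exists fbl : R,
       (forall i, (fun k => fl (x k i)) @ \oo --> fbl) /\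
       (fun k => fl (xbar k)) @ \oo --> fbl)
  /\
  (exists a : nat -> R,
     (forall k, 0 <= a k) /\
     (exists C : R, exists K : nat, forall k, (K <= k)%N ->
         a k <= C * (L ^+ 2 * beta k ^+ 2 / (1 - rhot) ^+ 2)) /\
     ((inf (range (fun k => frob (xbar k - P (xbar k)) ^+ 2)))%:E
        * (((2%:R * lam)^-1 - rho - L)%:E * \sum_(0 <= k <oo) (beta k)%:E)
      <= lam%:E * ((n%:R^-1 * \sum_(i < n) fl (x 0%N i))%:E
                   - (inf [set fl y | y in stiefel])%:E
                   + \sum_(0 <= k <oo) (a k)%:E
                   + \sum_(0 <= k <oo) (beta k ^+ 2 * L ^+ 2 / lam)%:E))%E).
Proof.
move=> rhot fl.
have SW : sym_stochastic W by split.
have Wpos i j : (j == i) || G i j -> 0 < W i j.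
  by move=> ij; rewrite lt_def HWsupp ij HWnn.
have s1 : sing2 W < 1.
  by apply: (sing2_lt1 SW HGconn) => [i|i j Gij]; apply: Wpos; rewrite ?eqxx ?Gij ?orbT.
set A := mxpow W t in rhot fl Halpha1 Hbeta Hiter *.
have SA : sym_stochastic A by exact: sym_stochastic_mxpow.
have mixA i : \sum_j `|A i j - n%:R^-1| <= 2%:R^-1 by exact: mxpow_row_l1_half.
have bp k : 0 < beta k by case: (Hbeta k).
have Hb k : beta k <= (1 - rhot) * delta1 / L /\ beta k <= alpha * delta1 / (5%:R * L).
  by have [_] := Hbeta k; rewrite le_min => /andP.
have L5 : 0 < 5%:R * L by rewrite mulr_gt0.
have b2 k : 5%:R * (beta k * L) <= alpha * delta1.
  by have [_] := Hb k; rewrite ler_pdivlMr //; lra.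
(* Positivity is forced by a positive stepsize lying below a multiple of [delta1]; [rho1] below
   follows in the same way. *)
have d10 : 0 < delta1.
  have := b2 0%N; have h : 0 < 5%:R * (beta 0%N * L) by rewrite !mulr_gt0.
  by move/(lt_le_trans h); rewrite pmulr_rgt0.
have b1 k : beta k * L <= (1 - rhot) * delta1 by have [+ _] := Hb k; rewrite ler_pdivlMr.
have rho1 : rhot < 1.
  have := b1 0%N; have h : 0 < beta 0%N * L by rewrite mulr_gt0.
  by move/(lt_le_trans h); rewrite pmulr_lgt0 // subr_gt0.
have sr : 0 < Num.sqrt (r%:R : R) by rewrite sqrtr_gt0 ltr0n.
have d12 : 5%:R * Num.sqrt r%:R * delta1 <= delta2.
  by move: Hd1; rewrite ler_pdivlMr ?mulr_gt0 // mulrC.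
have d20 : 0 < delta2 by apply: lt_le_trans d12; rewrite !mulr_gt0.
have d2s : delta2 ^+ 2 <= 1.
  by rewrite -(expr1n _ 2) ler_sqr ?nnegrE ?ltW //; lra.
have Hnu : 0 < nu < 1 by rewrite Hnu0.
have Lt0 : 0 <= 1 - eign A by rewrite subr_ge0 eign_le1.
have [Ha a1 aM] : [/\ alpha * (1 - eign A) <= nu * (2%:R - delta2 ^+ 2), alpha <= 1 & alpha * M <= 1].
  have aMM : alpha <= M^-1 -> alpha * M <= 1 by rewrite -[M^-1]mul1r ler_pdivlMr.
  (* When [1 - eign A = 0] the quotient is absent from [alphabar], and the first bound reduces to
     nonnegativity of its right side. *)
  move: Halpha1; rewrite /alphabar; case: eqVneq => [-> |e].
    rewrite le_min => /andP[h1 h2]; split; [|done|exact: aMM].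
    by rewrite mulr0 mulr_ge0 ?ltW //; lra.
  rewrite !le_min => /andP[h0 /andP[h1 h2]]; split; [|done|exact: aMM].
  by rewrite -ler_pdivlMr // lt_def e.
(* Otherwise [gamma_t] would be nonpositive and [rhot] at least 1, against [rho1]. *)
have mu0 : 0 <= 1 - eig2 A.
  rewrite leNgt; apply/negP => mu; move: rho1; apply/negP; rewrite -leNgt.
  rewrite /rhot /rho_t -[X in X <= _]sqrtr1 ler_wsqrtr // lerDl oppr_ge0.
  apply: mulr_ge0_le0; first by rewrite !mulr_ge0 ?ltW ?subr_gt0.
  apply: mulr_ge0_le0; last exact: ltW.
  by apply: mulr_ge0; [rewrite subr_ge0; exact: radius_bound d10 d12 Hd2|lra].
have [U [_ _ _ sU lipU]] := HU.
have Hlip i y z : stiefel y -> stiefel z -> `|f i y - f i z| <= L * frob (y - z).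
  by move=> /sU sy /sU; exact: lipU.
have /choice [xi Hxi] : forall p : nat * 'I_n, exists g, riem_subdiff rho (f p.2) (x p.1 p.2) g /\
    x p.1.+1 p.2 = polar_retr (x p.1 p.2) (alpha *: consensus_dir A (x p.1) p.2 - beta p.1 *: g).
  by move=> [k i]; have [g ? ?] := Hiter k i; exists g.
have xE k i : x k.+1 i = polar_retr (x k i) (alpha *: consensus_dir A (x k) i - beta k *: xi (k, i)).
  by have [_] := Hxi (k, i).
have sub k i : riem_subdiff rho (f i) (x k i) (xi (k, i)) by have [] := Hxi (k, i).
have tan k i : stiefel (x k i) -> tangent (x k i) (xi (k, i)).
  by move=> sx; have [g _ <-] := sub k i; exact: proj_tangent_tangent.
have bnd k i : stiefel (x k i) -> frob (xi (k, i)) <= L by move=> sx; exact: HLb (sub k i).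
have inv k : (forall i, stiefel (x k i)) /\ in_nbhd delta1 delta2 (x k) (xbar k).
  elim: k => [//|k [sx Nx]].
  have tk i := tan k i (sx i); have bk i := bnd k i (sx i).
  split; first by move=> i; exact: (step_stiefel sx tk (xE k)).
  exact: (step_nbhd Hn Hr HM HMr SA mixA d10 d12 Hd2 Hnu Halpha0 a1 aM Ha mu0 HL (bp k) (b1 k) (b2 k)
    sx (Hxbar k) Nx tk bk (xE k) (Hxbar k.+1)).
have sx k i : stiefel (x k i) by have [] := inv k.
have sb k : stiefel (xbar k) by have [] := Hxbar k.
have nb k : proj_tangent (xbar k) (mean (x k)) = 0.
  by apply: nearest_stiefel_normal (Hxbar k) => z; exact: HMr.
pose E k := frob (stack (fun i => x k i - xbar k)).
have E0 k : 0 <= E k by exact: frob_ge0.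
have Ei k i : frob (x k i - xbar k) <= E k.
  rewrite -(@ler_sqr _ (frob _)) ?nnegrE ?frob_ge0 // /E frob_stack (bigD1 i) //= lerDl.
  by apply: sumr_ge0 => j _; exact: sqr_ge0.
have ES k : E k.+1 <= rhot * E k + Num.sqrt n%:R * L * beta k.
  rewrite [_ * _ * beta k]mulrC.
  exact: (step_consensus Hn Hr HMr SA d10 d12 Hd2 Hnu Halpha0 Ha mu0 HL (bp k)
    (sx k) (Hxbar k) (proj2 (inv k)) (fun i => tan k i (sx k i)) (fun i => bnd k i (sx k i)) (xE k) (Hxbar k.+1)).
have [C [K [C0 EC]]] : exists C K, 0 <= C /\ forall k, (K <= k)%N -> E k <= C * beta k.
  apply: geometric_forcing Hbratio ES => //; first by rewrite sqrtr_ge0.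
  by rewrite mulr_ge0 ?sqrtr_ge0 // ltW.
pose D k := frob (xbar k - P (xbar k)) ^+ 2.
pose v k := fl (xbar k).
pose c := ((2%:R * lam)^-1 - (rho + L) / 2%:R) / lam.
(* Collects the errors of [envelope_descent] once [E k] is bounded by [C * beta k]: the two offsets
   of the means together give [n^-1 C^2], and the other terms come from the mean drift. *)
pose C' := lam^-1 * ((L + (rho + L) * Num.sqrt r%:R) * C + Num.sqrt r%:R *
  (n%:R^-1 * C ^+ 2 + 10%:R * alpha * n%:R^-1 * C ^+ 2 + 2%:R * M * L ^+ 2)).
have rL : 0 < rho + L by rewrite ltr_wpDl.
have np : 0 < (n%:R : R) by rewrite ltr0n.
have c0 : 0 < c.
  have lam1 : lam < (2%:R * (rho + L))^-1 by move: Hlam1; rewrite lt_min => /andP[].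
  have h : lam * (2%:R * (rho + L)) < 1 by move: lam1; rewrite -[X in _ < X -> _]mul1r ltr_pdivlMr ?mulr_gt0.
  have l2 : 0 < 2%:R * lam by rewrite mulr_gt0.
  have lL : 0 < lam * (rho + L) by rewrite mulr_gt0.
  have h1 : (rho + L) / 2%:R < (2%:R * lam)^-1.
    by rewrite -[X in _ < X]mul1r ltr_pdivlMr //; lra.
  by apply: divr_gt0 => //; rewrite subr_gt0.
have C'0 : 0 <= C'.
  have n1 : 0 <= n%:R^-1 :> R by rewrite invr_ge0 ltW.
  rewrite /C' !(mulr_ge0, addr_ge0) ?sqr_ge0 ?invr_ge0 //; exact: ltW.
have desc k : (K <= k)%N -> v k.+1 <= v k - c * (beta k * D k) + C' * beta k ^+ 2.
  move=> Kk; have h0 : 0 <= (2%:R * n%:R)^-1 :> R by rewrite invr_ge0 mulr_ge0 // ltW.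
  have n1 : 0 <= n%:R^-1 :> R by rewrite invr_ge0 ltW.
  have Eb := EC k Kk.
  (* Since stepsizes do not increase, the error after the step is also measured by [beta k]. *)
  have Eb' : E k.+1 <= C * beta k by apply: le_trans (EC _ (leqW Kk)) _; apply: ler_wpM2l.
  have sq l : E l <= C * beta k -> \sum_i frob (x l i - xbar l) ^+ 2 <= (C * beta k) ^+ 2.
    by move=> h; rewrite -frob_stack ler_sqr ?nnegrE ?frob_ge0 // (le_trans (E0 l) h).
  have m1 l : E l <= C * beta k -> frob (mean (x l) - xbar l) <= (2%:R * n%:R)^-1 * (C * beta k) ^+ 2.
    move=> h; apply: le_trans (frob_mean Hn (sx l) (sb l) (nb l)) _.
    by apply: ler_wpM2l => //; exact: sq.
  have m3 := step_mean_drift Hn HM HMr SA Halpha0 aM HL (bp k) (xbar k) (sx k)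
    (fun i => tan k i (sx k i)) (fun i => bnd k i (sx k i)) (xE k).
  have m4 : 10%:R * alpha * (n%:R^-1 * \sum_i frob (x k i - xbar k) ^+ 2) <= 10%:R * alpha * (n%:R^-1 * (C * beta k) ^+ 2).
    apply: ler_wpM2l; first by rewrite mulr_ge0 // ltW.
    by apply: ler_wpM2l => //; exact: sq.
  have := envelope_descent Hn Hlam0 HL Hrho HP Hlip (sx k) (sb k) (sb k.+1) (bp k)
    (fun i => le_trans (Ei k i) Eb) (fun i => tan k i (sx k i))
    (fun i y sy => Hlow i (x k i) y (xi (k, i)) (sx k i) sy (sub k i))
    (m1 k Eb) (m1 k.+1 Eb') (le_trans m3 (lerD m4 (lexx _))).
  rewrite -/fl -/(v k) -/(v k.+1) -/(D k) -/c => h; apply: le_trans h _.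
  rewrite le_eqVlt; apply/orP; left; apply/eqP; rewrite /C'.
  by field; rewrite !gt_eqF.
have [l lv] := moreau_lower Hn Hlam0 HL HP Hlip (sb 0%N).
have main : (\sum_(0 <= k <oo) (beta k ^+ 2)%:E < +oo)%E ->
    (exists lim : R, v @ \oo --> lim) /\ inf (range D) = 0.
  move=> fin; have [B HB] := nneseries_bounded (fun k => sqr_ge0 (beta k)) fin.
  have D0 k : 0 <= D k by exact: sqr_ge0.
  have lv' k : l <= v k by exact: lv.
  split; first exact: (descent_cvg c0 C'0 D0 bp lv' HB desc).
  apply: (descent_inf0 c0 C'0 D0 bp lv' HB desc).
  exact: nneseries_unbounded (fun k => ltW (bp k)) Hbsum.
split.
  move=> fin; have [[fbl vl] _] := main fin; exists fbl; split=> // i.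
  (* The points are within [C * beta k] of the projected mean and the envelope is Lipschitz, so this
     null sequence transfers the limit to each agent. *)
  have E_0 : (fun k => Num.sqrt r%:R / lam * (C * beta k)) @ \oo --> (0 : R).
    have -> : (fun k => Num.sqrt r%:R / lam * (C * beta k)) = (fun k => Num.sqrt r%:R / lam * C * beta k).
      by apply/funext => k; rewrite mulrA.
    rewrite -[X in _ --> X](mulr0 (Num.sqrt r%:R / lam * C)).
    by apply: cvgM => //; exact: cvg_cst.
  have dif : (fun k => fl (x k i) - v k) @ \oo --> (0 : R).
    apply/cvgrPdist_lt => e e0; have [N _ HN] := (cvgrPdist_lt _ _).1 E_0 e e0.
    exists (maxn N K) => // k /=; rewrite geq_max => /andP[Nk Kk].
    rewrite sub0r normrN; apply: le_lt_trans (HN k Nk).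
    rewrite sub0r normrN; apply: le_trans (moreau_lipschitz Hlam0 HP (sx k i) (sb k)) _.
    apply: le_trans (ler_norm _); apply: ler_wpM2l; first by rewrite divr_ge0 ?sqrtr_ge0 // ltW.
    exact: le_trans (Ei k i) (EC k Kk).
  have -> : (fun k => fl (x k i)) = (fun k => fl (x k i) - v k + v k).
    by apply/funext => k; rewrite subrK.
  by rewrite -[fbl]add0r; exact: cvgD dif vl.
exists (fun=> 0); split=> //; split; first by exists 0, 0%N => k _; rewrite mul0r.
(* Every envelope value is at least the infimum, so the right side of (ii) is a sum of nonnegative
   terms. *)
have avg0 : (0 <= (n%:R^-1 * \sum_(i < n) fl (x 0%N i))%:E - (inf [set fl y | y in stiefel])%:E)%E.
  rewrite -EFinB lee_fin subr_ge0 ler_pdivlMl //.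
  apply: le_trans (_ : \sum_(i < n) inf [set fl y | y in stiefel] <= _).
    by rewrite sumr_const card_ord mulr_natl.
  apply: ler_sum => i _; apply: ge_inf; last by exists (x 0%N i).
  by exists l => _ [y sy <-]; exact: lv.
have sum0 : (0 <= \sum_(0 <= k <oo) (0 : R)%:E)%E by apply: nneseries_ge0.
have w0 k : 0 <= beta k ^+ 2 * L ^+ 2 / lam by rewrite divr_ge0 ?mulr_ge0 ?sqr_ge0 // ltW.
(* In the summable case the infimum on the left is 0, and 0 times the infinite sum is 0 in the
   extended reals, so nonnegativity of the right side suffices. *)
have [fin|] := boolP (\sum_(0 <= k <oo) (beta k ^+ 2)%:E < +oo)%E.
  have [_ ->] := main fin; rewrite mul0e; apply: mule_ge0; first by rewrite lee_fin ltW.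
  apply: adde_ge0; first exact: adde_ge0.
  by apply: nneseries_ge0 => k _ _; rewrite lee_fin.
(* In the other case the last series is infinite. The other summands are nonnegative, hence not
   minus infinity, and the right side is infinite. *)
rewrite -leNgt leye_eq => /eqP inf2.
have -> : (\sum_(0 <= k <oo) (beta k ^+ 2 * L ^+ 2 / lam)%:E = +oo)%E.
  rewrite (eq_eseriesr (g := fun k => ((L ^+ 2 / lam)%:E * (beta k ^+ 2)%:E)%E)) => [|k _].
    rewrite nneseriesZl => [|k _]; last by rewrite lee_fin sqr_ge0.
    by rewrite inf2 gt0_muley // lte_fin divr_gt0 // exprn_gt0.
  by rewrite -EFinM; congr EFin; rewrite -mulrA mulrC.
rewrite addey ?gt0_muley ?lte_fin ?leey //.
by rewrite gt_eqF // (lt_le_trans (ltNy0)) // adde_ge0.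
Qed.
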